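(* Let $F$ be a regular nonlinearity, let $\alpha\ge0$, and let $B$ be the unit ball of $\mathbb{R}^N$. If $N<10+4\alpha$, then the extremal solution $u^*_\alpha$ of $-\Delta u=\lambda|x|^\alpha F(u)$ in $B$, $u=0$ on $\partial B$, is classical.
   Context: A regular nonlinearity $F$ is a smooth, increasing, convex function on $[0,\infty)$ with $F(0)=1$ that is superlinear (i.e. $F(u)/u\to\infty$ as $u\to\infty$). A solution of $-\Delta u=\lambda|x|^\alpha F(u)$ in $B$, $u=0$ on $\partial B$, is classical if $\|u\|_{L^\infty}<\infty$. The extremal parameter $\lambda^*$ is the supremum of the $\lambda>0$ for which a classical solution exists; for $0<\lambda<\lambda^*$ there is a minimal classical solution $u_\lambda$ (any other solution $v$ satisfies $v\ge u_\lambda$ a.e.), increasing in $\lambda$, and the extremal solution is $u^*_\alpha(x):=\lim_{\lambda\nearrow\lambda^*}u_\lambda(x)$, the unique weak solution at $\lambda=\lambda^*$. *)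

(* Defs.v *)
From HB Require Import structures.
From mathcomp Require Import all_boot all_order all_algebra.
From mathcomp Require Import all_classical all_reals all_analysis.

Set Implicit Arguments.
Unset Strict Implicit.
Unset Printing Implicit Defensive.

Import Order.TTheory GRing.Theory Num.Theory.
Import numFieldNormedType.Exports.

Local Open Scope classical_set_scope.
Local Open Scope ring_scope.

(* The Borel sigma-algebra of R^n, generated by the coordinate maps. *)

Definition rV_display : measure_display.
Proof. exact: default_measure_display. Qed.

Section rV_measurable.
Context {R : realType} (n : nat).

Definition coord_rV (i : 'I_n) (x : 'rV[R]_n) : measurableTypeR R := x ord0 i.

Let rV_set0 : g_sigma_preimage coord_rV set0.
Proof. exact: sigma_algebra0. Qed.

Let rV_setC A : g_sigma_preimage coord_rV A -> g_sigma_preimage coord_rV (~` A).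
Proof. exact: sigma_algebraC. Qed.

Let rV_bigcup (A : _^nat) : (forall i, g_sigma_preimage coord_rV (A i)) ->
  g_sigma_preimage coord_rV (\bigcup_i (A i)).
Proof. exact: sigma_algebra_bigcup. Qed.

HB.instance Definition _ := @isMeasurable.Build rV_display
  'rV[R]_n (g_sigma_preimage coord_rV) rV_set0 rV_setC rV_bigcup.

End rV_measurable.

Lemma measurable_coord_rV (R : realType) n (i : 'I_n) :
  measurable_fun [set: 'rV[R]_n] (coord_rV i).
Proof.
move=> _ Y mY; rewrite setTI; apply: sub_sigma_algebra => /=.
rewrite -bigcup_seq/=; exists i => /=; first by rewrite mem_index_enum.
by exists Y => //; rewrite setTI.
Qed.

Lemma measurable_fun_rV d (T : measurableType d) (R : realType) n
    (f : T -> 'rV[R]_n) :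
  (forall i, measurable_fun [set: T] (coord_rV i \o f)) ->
  measurable_fun [set: T] f.
Proof.
move=> mf _ Y mY.
have sub : g_sigma_preimage (fun i => coord_rV i \o f) `<=` measurable.
  apply: smallest_sub; first exact: sigma_algebra_measurable.
  move=> A; rewrite -bigcup_seq => -[i _ [B mB <-]].
  exact: mf.
by apply: sub; rewrite g_sigma_preimage_comp; exists Y.
Qed.

Definition cons_rV {R : realType} {n} (p : measurableTypeR R * 'rV[R]_n) :
  'rV[R]_n.+1 := \row_i (if unlift ord0 i is Some j then p.2 ord0 j else p.1).

Lemma measurable_cons_rV (R : realType) n :
  measurable_fun [set: measurableTypeR R * 'rV[R]_n] (@cons_rV R n).
Proof.
apply: measurable_fun_rV => i; rewrite /comp /coord_rV /cons_rV.
under eq_fun do rewrite mxE.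
case: unliftP => [j _|_]; last exact: measurable_fst.
exact: (measurableT_comp (measurable_coord_rV j)).
Qed.

Section cons_measure.
Context {R : realType} {n : nat}.
Variable mu : {sigma_finite_measure set 'rV[R]_n -> \bar R}.

Definition cons_measure : set 'rV[R]_n.+1 -> \bar R :=
  pushforward (@lebesgue_measure R \x mu)%E cons_rV.

Let m : {measure set 'rV[R]_n.+1 -> \bar R} :=
  measure_function_pushforward__canonical__measure_function_Measure
    (@lebesgue_measure R \x mu)%E (@measurable_cons_rV R n).

Let cons_measure0 : cons_measure set0 = 0%E.
Proof. exact: (measure0 m). Qed.

Let cons_measure_ge0 A : (0 <= cons_measure A)%E.
Proof. exact: (measure_ge0 m). Qed.

Let cons_measure_sigma_additive : semi_sigma_additive cons_measure.
Proof. exact: (@measure_semi_sigma_additive _ _ _ m). Qed.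

HB.instance Definition _ := isMeasure.Build _ _ _ cons_measure
  cons_measure0 cons_measure_ge0 cons_measure_sigma_additive.

Let cons_measure_sigma_finite : sigma_finite setT cons_measure.
Proof.
have /sigma_finiteP[G1 [TG1 ndG1 G1oo]] := sigma_finiteT (@lebesgue_measure R).
have /sigma_finiteP[G2 [TG2 ndG2 G2oo]] := sigma_finiteT mu.
pose G k := G1 k `*` G2 k.
have TG : setT = \bigcup_k G k.
  rewrite -setXTT TG1 TG2 predeqE => -[x y]; split.
    move=> [/= [k _ G1x] [l _ G2y]]; exists (maxn k l) => //; split.
    - by move: x G1x; exact/subsetPset/ndG1/leq_maxl.
    - by move: y G2y; exact/subsetPset/ndG2/leq_maxr.
  by move=> [k _ []/= ? ?]; split; exists k.
have Goo k : measurable (G k) /\ ((@lebesgue_measure R \x mu) (G k) < +oo)%E.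
  have [? ?] := G1oo k; have [? ?] := G2oo k.
  split; first exact: measurableX.
  by rewrite product_measure1E// lte_mul_pinfty// ge0_fin_numE.
pose tl (x : 'rV[R]_n.+1) : measurableTypeR R * 'rV[R]_n :=
  (x ord0 ord0, \row_j x ord0 (lift ord0 j)).
have tlK p : tl (cons_rV p) = p.
  case: p => a y; rewrite /tl /cons_rV; congr pair.
    by rewrite mxE unlift_none.
  by apply/rowP => j; rewrite !mxE liftK.
have mtl : measurable_fun setT tl.
  apply: measurable_fun_pair; first exact: (measurable_coord_rV ord0).
  apply: measurable_fun_rV => j; rewrite /comp /coord_rV.
  under eq_fun do rewrite mxE.
  exact: (measurable_coord_rV (lift ord0 j)).
exists (fun k => tl @^-1` G k).
  by rewrite -preimage_bigcup -TG preimage_setT.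
move=> k; have [mG Gk] := Goo k; split.
  by rewrite -[X in measurable X]setTI; exact: mtl.
rewrite /cons_measure /pushforward -comp_preimage.
by rewrite (_ : tl \o cons_rV = id)//; exact/funext.
Qed.

HB.instance Definition _ := @Measure_isSigmaFinite.Build _ _ _ cons_measure
  cons_measure_sigma_finite.

End cons_measure.

Fixpoint lebesgue_rV (R : realType) (n : nat) :
    {sigma_finite_measure set 'rV[R]_n -> \bar R} :=
  match n with
  | 0 => dirac (0 : 'rV[R]_0)
  | m.+1 => cons_measure (lebesgue_rV R m)
  end.

Lemma lebesgue_rV_prod (R : realType) n (A : 'I_n -> set (measurableTypeR R)) :
  (forall i, measurable (A i)) ->
  lebesgue_rV R n [set x | forall i, A i (coord_rV i x)] =
  (\prod_(i < n) lebesgue_measure (A i))%E.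
Proof.
elim: n A => [|n IH] A mA /=.
  by rewrite big_ord0 diracE mem_set// => -[].
rewrite big_ord_recl /cons_measure /pushforward.
pose B := [set x : 'rV[R]_n | forall i, A (lift ord0 i) (coord_rV i x)].
have mB : measurable B.
  rewrite (_ : B = \bigcap_(i in [set: 'I_n])
      (coord_rV i @^-1` A (lift ord0 i))); last first.
    by apply/seteqP; split=> x /= h i; [move=> _|]; exact: h.
  apply: fin_bigcap_measurable => // i _.
  by rewrite -[X in measurable X]setTI; exact: measurable_coord_rV.
rewrite -IH// -product_measure1E//; congr (_ _).
apply/seteqP; split=> -[t x] /=.
  move=> h; split; first by have := h ord0; rewrite /coord_rV mxE unlift_none.
  by move=> i; have := h (lift ord0 i); rewrite /coord_rV mxE liftK.
move=> [tA xB] i; rewrite /coord_rV mxE.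
by case: unliftP => [j ->|->]; [exact: xB|].
Qed.

(* The norm of 'rV[R]_N is the sup norm, hence an explicit Euclidean norm. *)
Definition enorm {R : realType} {N : nat} (x : 'rV[R]_N) : R :=
  Num.sqrt (\sum_(i < N) x ord0 i ^+ 2).

Definition unit_ball (R : realType) (N : nat) : set 'rV[R]_N :=
  [set x | enorm x < 1].

Definition closed_unit_ball (R : realType) (N : nat) : set 'rV[R]_N :=
  [set x | enorm x <= 1].

Arguments unit_ball R N : clear implicits.
Arguments closed_unit_ball R N : clear implicits.

Section regular_nonlinearity.
Context {R : realType}.

(* C^oo on [0, +oo[: all derivatives exist on ]0, +oo[ and extend continuously
   to 0. The values of F on the negative reals are irrelevant. *)
Definition smooth_nneg (F : R -> R) : Prop :=
  [/\ {within `[0, +oo[, continuous F},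
      forall n x, 0 < x -> derivable (derive1n n F) x 1 &
      forall n, cvg (derive1n n F x @[x --> 0^'+])].

Definition regular_nonlinearity (F : R -> R) : Prop :=
  [/\ smooth_nneg F,
      forall s t, 0 <= s -> s <= t -> F s <= F t,
      convex_function (`[0, +oo[%classic : set R) F,
      F 0 = 1 &
      F t / t @[t --> +oo] --> +oo].

End regular_nonlinearity.

Section test_functions.
Context {R : realType} {N : nat}.

Definition basis_rV (i : 'I_N) : 'rV[R]_N := delta_mx ord0 i.

Definition laplacian (phi : 'rV[R]_N -> R) (x : 'rV[R]_N) : R :=
  \sum_(i < N) 'D_(basis_rV i) ('D_(basis_rV i) phi) x.

Definition extends_to_closed_ball (f : 'rV[R]_N -> R) : Prop :=
  exists2 g : 'rV[R]_N -> R, {within closed_unit_ball R N, continuous g} &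
    forall x, unit_ball R N x -> f x = g x.

(* phi is C^2 on the closed ball (partial derivatives of order at most 2 exist
   in the open ball and extend continuously to the closed one) and vanishes on
   the sphere. *)
Definition test_function (phi : 'rV[R]_N -> R) : Prop :=
  [/\ {within closed_unit_ball R N, continuous phi},
      forall x, enorm x = 1 -> phi x = 0,
      forall i x, unit_ball R N x -> derivable phi x (basis_rV i),
      forall i j x, unit_ball R N x ->
        derivable ('D_(basis_rV i) phi) x (basis_rV j) &
      (forall i, extends_to_closed_ball ('D_(basis_rV i) phi)) /\
      (forall i j, extends_to_closed_ball
         ('D_(basis_rV j) ('D_(basis_rV i) phi)))].

End test_functions.

Section henon_problem.
Context {R : realType} {N : nat}.
Variables (alpha : R) (F : R -> R).

Local Notation B := (unit_ball R N).
Local Notation mu := (lebesgue_rV R N).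

(* Very weak (L^1) solution of - Delta u = lambda |x|^alpha F(u) in B, u = 0 on
   the boundary; 1 - |x| is the distance from x to the boundary of B. As F is
   only meaningful on [0, +oo[, representatives are taken nonnegative
   everywhere in B. *)
Definition weak_solution (lambda : R) (u : 'rV[R]_N -> R) : Prop :=
  [/\ forall x, B x -> 0 <= u x,
      mu.-integrable B (fun x => (u x)%:E),
      mu.-integrable B
        (fun x => (enorm x `^ alpha * F (u x) * (1 - enorm x))%:E) &
      forall phi, test_function phi ->
        \int[mu]_(x in B) (u x * - laplacian phi x) =
        \int[mu]_(x in B) (lambda * enorm x `^ alpha * F (u x) * phi x)].

Definition classical_solution (lambda : R) (u : 'rV[R]_N -> R) : Prop :=
  weak_solution lambda u /\ ('N[mu]_+oo [EFin \o (u \_ B)] < +oo)%E.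

Definition is_extremal_parameter (lambdastar : R) : Prop :=
  ereal_sup [set lambda%:E | lambda in
    [set lambda | 0 < lambda /\ exists u, classical_solution lambda u]] =
  lambdastar%:E.

Definition minimal_classical_solution (lambda : R) (u : 'rV[R]_N -> R) : Prop :=
  classical_solution lambda u /\
  forall v, weak_solution lambda v -> {ae mu, forall x, B x -> u x <= v x}.

(* Solutions being defined up to null sets, the limit is an a.e. one, and ustar
   is a measurable nonnegative representative of it. *)
Definition extremal_solution (lambdastar : R) (ustar : 'rV[R]_N -> R) : Prop :=
  [/\ measurable_fun B ustar,
      forall x, B x -> 0 <= ustar x &
      exists u : R -> 'rV[R]_N -> R,
        (forall lambda, 0 < lambda < lambdastar ->
           minimal_classical_solution lambda (u lambda)) /\
        {ae mu, forall x, B x ->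
           u lambda x @[lambda --> lambdastar^'-] --> ustar x}].

End henon_problem.

Arguments is_extremal_parameter {R} N alpha F lambdastar.

(* Main.v *)
Require Import Defs.
From mathcomp Require Import all_boot all_order all_algebra.
From mathcomp Require Import all_classical all_reals all_analysis.
From mathcomp Require Import measurable_realfun ess_sup_inf.
From mathcomp Require Import ring lra.

Set Implicit Arguments.
Unset Strict Implicit.
Unset Printing Implicit Defensive.

Import Order.TTheory GRing.Theory Num.Theory.
Import numFieldNormedType.Exports.

Local Open Scope classical_set_scope.
Local Open Scope ring_scope.

(** Write n + 1 for the dimension. The minimal solutions are bounded by comparing
them with radial solutions, for which stability gives a uniform bound.

Fix lam below the extremal parameter and let u be a bounded weak solution. The
radial problem has a monotone iteration: V_0 = 0 and V_(k+1) is the radial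
potential of lam |x|^alpha F(V_k), an explicit double integral. Testing the
weak equation for u with the radial potential phi of an arbitrary continuous
chi >= 0, and bounding F below by its tangent at the radial number V_k(|x|),
gives by induction on k that u - V_k has a nonnegative integral against every
radial weight ([iterate_comparison]). This averaged form of a maximum principle
suffices: the V_k stay below the essential supremum of u
([iterate_bounded]), so they converge to a bounded radial solution
([radial_solution_fixpoint]). By Green's identity ([green_identity]) that limit
is a weak solution in the sense of arbitrary test functions
([radial_solution_classical]), so the minimal solution lies below it. Green's
identity is proved one line parallel to an axis at a time: along a chord of the
ball both functions vanish at the two ends, so it is the fundamental theorem of
calculus there.

It remains to bound the radial solution V of parameter lam uniformly in lam.
Away from the origin, V(r) >= c F(V(r)) by positivity of the kernel, and the
superlinearity of F bounds V(r) ([sol_lower], [superlinear]). Near the origin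
the bound comes from stability. For lam < lam' the difference w of the radial
solutions is a positive supersolution of the equation linearized at V, because F
is convex ([stable_pair]). Picone's inequality for w, tested against
z r^(-b) (1 - 2 r) with z = - V', together with the equation satisfied by z,
shows that z^2 r^(n - 2 b - 2) (D - E r) is at most minus the derivative of an
energy that vanishes at r = 1/2 and has nonpositive upper limit at r = 0
([energy_derive_le], [energy_upper]); here
D = n + alpha (n + 1) / 2 + alpha b - b^2. If D > 0 and 2 b > n - 3, this
controls the integral of z near the origin by the Cauchy-Schwarz (or Young)
inequality. Such a b exists for n >= 1 precisely because
n + 1 < 10 + 4 alpha ([exponent_window]); for n = 0 the equation already
bounds z. All these steps are carried out as differential inequalities, up to
[stable_radial_bound].

Hence the minimal solutions are bounded uniformly as lam increases to the
extremal parameter, and dominated convergence passes the weak equation to the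
limit ([weak_solution_limit]). *)

(** * Differential inequalities on an interval *)

Section calculus.
Context {R : realType}.
Implicit Types (f g : R -> R) (x a b : R).

Lemma is_deriveD_fun f g x a b : is_derive x 1 f a -> is_derive x 1 g b ->
  is_derive x 1 (fun y => f y + g y) (a + b).
Proof. by move=> fa gb; exact: is_deriveD. Qed.

Lemma is_deriveB_fun f g x a b : is_derive x 1 f a -> is_derive x 1 g b ->
  is_derive x 1 (fun y => f y - g y) (a - b).
Proof. by move=> fa gb; exact: is_deriveB. Qed.

Lemma is_deriveM_fun f g x a b : is_derive x 1 f a -> is_derive x 1 g b ->
  is_derive x 1 (fun y => f y * g y) (a * g x + f x * b).
Proof.
move=> fa gb; apply: (@is_derive_eq _ _ _ (f * g)) (is_deriveM fa gb) _.
by rewrite /GRing.scale/=; ring.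
Qed.

Lemma is_derive_div_fun f g x a b : g x != 0 ->
  is_derive x 1 f a -> is_derive x 1 g b ->
  is_derive x 1 (fun y => f y / g y) ((a * g x - f x * b) / g x ^+ 2).
Proof.
move=> gx0 fa gb.
apply: is_derive_eq (is_deriveM_fun fa (is_deriveV gx0 gb)) _.
by rewrite /GRing.scale/=; field.
Qed.

Lemma is_derive_cst_fun (c x : R) : is_derive x 1 (fun=> c) 0.
Proof. exact: is_derive_cst. Qed.

Lemma is_deriveZ_fun (c : R) f x a : is_derive x 1 f a ->
  is_derive x 1 (fun y => c * f y) (c * a).
Proof.
move=> fa; apply: is_derive_eq (is_deriveM_fun (is_derive_cst_fun c x) fa) _.
by ring.
Qed.

Lemma is_derive_id_fun x : is_derive x 1 (fun y => y : R) 1.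
Proof. exact: is_derive_id. Qed.

Lemma is_derive_sqr_fun f x a : is_derive x 1 f a ->
  is_derive x 1 (fun y => f y ^+ 2) (2 * f x * a).
Proof.
move=> fa; apply: (@is_derive_eq _ _ _ (f ^+ 2)) (is_deriveX 2 fa) _.
by rewrite /GRing.scale/= expr1.
Qed.

Lemma is_derive_exprn_fun n x :
  is_derive x 1 (fun y => y ^+ n : R) (n%:R * x ^+ n.-1).
Proof.
apply: DeriveDef; first exact: exprn_derivable.
by rewrite exp_derive /GRing.scale/= mulr1.
Qed.

Lemma is_derive_powR_fun (s x : R) : 0 < x ->
  is_derive x 1 (fun y => y `^ s) (s * x `^ s / x).
Proof.
move=> x0; apply: is_derive_eq; first exact: is_derive1_powR.
by rewrite powRB ?powRr1 ?ltW ?mulrA// (gt_eqF x0) implybT.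
Qed.

Lemma is_derive_continuous f x a : is_derive x 1 f a -> {for x, continuous f}.
Proof. by move=> [/derivable1_diffP/differentiable_continuous]. Qed.

Lemma derive_le0_le f (df : R -> R) a b : a <= b ->
  (forall x, a <= x <= b -> is_derive x 1 f (df x)) ->
  (forall x, a <= x <= b -> df x <= 0) -> f b <= f a.
Proof.
move=> ab fd df0.
have fd' x : x \in `]a, b[ -> is_derive x 1 f (df x).
  by rewrite in_itv/= => /andP[/ltW ? /ltW ?]; apply: fd; apply/andP.
have cf : {within `[a, b], continuous f}.
  apply: continuous_in_subspaceT => x; rewrite inE/= in_itv/= => /fd.
  exact: is_derive_continuous.
have [c cab E] := MVT_segment ab fd' cf.
rewrite -subr_le0 E; apply: mulr_le0_ge0; last by rewrite subr_ge0.
by apply: df0; move: cab; rewrite in_itv.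
Qed.

Lemma derive_le_le f g (df dg : R -> R) a b : a <= b ->
  (forall x, a <= x <= b -> is_derive x 1 f (df x)) ->
  (forall x, a <= x <= b -> is_derive x 1 g (dg x)) ->
  (forall x, a <= x <= b -> df x <= dg x) -> f b - f a <= g b - g a.
Proof.
move=> ab fd gd dfg.
have : f b - g b <= f a - g a.
  apply: (@derive_le0_le (fun x => f x - g x) (fun x => df x - dg x)) => //.
    by move=> x xab; apply: is_deriveB_fun; [exact: fd|exact: gd].
  by move=> x xab; rewrite subr_le0 dfg.
by lra.
Qed.

Lemma derive_eq_sub f g (df : R -> R) a b : a <= b ->
  (forall x, a <= x <= b -> is_derive x 1 f (df x)) ->
  (forall x, a <= x <= b -> is_derive x 1 g (df x)) ->
  f b - f a = g b - g a.
Proof.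
move=> ab fd gd; apply/le_anti/andP; split.
  exact: (derive_le_le ab fd gd).
exact: (derive_le_le ab gd fd).
Qed.

End calculus.

Section exponent.
Context {R : realType}.

(** The first two conditions make r^(2 b + 2 - n) integrable at 0 and the
boundary term of the energy vanish there; the third is its coercivity. At
2 b = n - 3 the quadratic form equals (n - 1) (n - 9 - 4 alpha) / 4, which is
negative when n > 1, so that b may be taken slightly larger; when n = 1 it is
zero, and b = 0 is taken instead. *)
Lemma exponent_window (n : nat) (alpha : R) : (0 < n)%N -> 0 <= alpha ->
  n.+1%:R < 10 + 4 * alpha ->
  exists b : R, [/\ n%:R - 3 < 2 * b, 2 * b < n%:R + 1 &
    b ^+ 2 - alpha * b - (n%:R + alpha * n.+1%:R / 2) < 0].
Proof.
move=> n0 a0; rewrite -natr1 => Na.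
have [n1|n1] := leqP n 1.
  have -> : n = 1%N by apply/eqP; rewrite eqn_leq n1.
  exists 0; split; lra.
have n2 : 2 <= n%:R :> R by rewrite ler_nat.
set N : R := n%:R + 1 in Na *.
have N3 : 3 <= N by rewrite /N; lra.
pose D := (N - 2) * (10 + 4 * alpha - N) / 4.
have D0 : 0 < D by rewrite /D divr_gt0// mulr_gt0//; lra.
(* small enough for the increment t (N - 4 - alpha + t) to stay below D *)
pose t := Num.min 1 (D / (2 * N)).
have t0 : 0 < t by rewrite lt_min ltr01/= divr_gt0//; lra.
have t1 : t <= 1 by rewrite ge_min lexx.
have tD : t * (2 * N) <= D.
  by rewrite -ler_pdivlMr ?ge_min ?lexx ?orbT//; lra.
exists ((N - 4) / 2 + t); split.
- by rewrite /N; lra.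
- by lra.
- have -> : ((N - 4) / 2 + t) ^+ 2 - alpha * ((N - 4) / 2 + t) -
      (n%:R + alpha * N / 2) = - D + t * (N - 4 - alpha) + t ^+ 2.
    by rewrite /D /N; field.
  have : t * (t + N - 4 - alpha) <= t * N by rewrite ler_wpM2l//; lra.
  by lra.
Qed.

End exponent.

Section singular_estimate.
Context {R : realType}.

(** The right-hand side minus the left-hand side is a square, namely Picone's
square (eta' - eta w' / w)^2 for eta = z r^(-b) (1 - 2 r), plus a multiple of
the defect G - c w of the supersolution w. *)
Lemma picone_inequality (n al b r q z w W1 y c G : R) :
  0 < r -> 0 < w -> 0 <= q -> c * w <= G ->
  let m := 1 - 2 * r in
  let g := y + n * z / r in
  let dW := ((- n * W1 / r - G) * w - W1 * W1) / w ^+ 2 in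
  let dy := al * g / r - c * z - (n * y * r - n * z) / r ^+ 2 in
  let X := W1 / w * z ^+ 2 - y * z + al / 2 * (z ^+ 2 / r) in
  let dX := dW * z ^+ 2 + W1 / w * (2 * z * y) - (dy * z + y * y) +
     al / 2 * ((2 * z * y * r - z ^+ 2) / r ^+ 2) in
  (n - 2 * b) * q / r * (m ^+ 2 * X) +
    q * (2 * m * (- 2) * X + m ^+ 2 * dX) <=
  q * (z ^+ 2 / r ^+ 2) *
  ((b * m + 2 * r) ^+ 2 - al * m * (b * m + 2 * r)
   - (n + al * (n + 1) / 2) * m ^+ 2).
Proof.
move=> r0 w0 q0 cG; lazy zeta; rewrite -subr_ge0; set m := 1 - 2 * r.
rewrite [leRHS](_ : _ =
  q * (m * (W1 / w * z - y) + z * (b * m + 2 * r) / r) ^+ 2 +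
  q * m ^+ 2 * z ^+ 2 * ((G - c * w) / w)); last first.
  by rewrite /m; field; rewrite !gt_eqF.
apply: addr_ge0; first by rewrite mulr_ge0// sqr_ge0.
apply: mulr_ge0; first exact: mulr_ge0 (mulr_ge0 q0 (sqr_ge0 _)) (sqr_ge0 _).
by rewrite divr_ge0 ?subr_ge0// ltW.
Qed.

End singular_estimate.

(** * An energy inequality for stable radial profiles *)

Section stable_radial.
Context {R : realType}.

Lemma quadratic_form_bound (al b K r : R) : 0 <= al -> 0 < r <= 1 / 2 ->
  let D := K + al * b - b ^+ 2 in
  let m := 1 - 2 * r in
  0 < D ->
  (b * m + 2 * r) ^+ 2 - al * m * (b * m + 2 * r) - K * m ^+ 2 <=
  - D + (4 * D + 4 * `|b| + 2) * r.
Proof.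
move=> al0 /andP[r0 r1] D m D0.
have -> : (b * m + 2 * r) ^+ 2 - al * m * (b * m + 2 * r) - K * m ^+ 2 =
  - D * m ^+ 2 + (4 * b * m * r - 2 * al * m * r + 4 * r ^+ 2).
  by rewrite /D; ring.
have m0 : 0 <= m by rewrite /m; lra.
have m1 : m <= 1 by rewrite /m; lra.
have h1 : - D * m ^+ 2 <= - D + 4 * D * r.
  have -> : m ^+ 2 = 1 - 4 * r + 4 * r ^+ 2 by rewrite /m; ring.
  by have := mulr_ge0 (ltW D0) (sqr_ge0 r); lra.
have h2 : 4 * b * m * r <= 4 * `|b| * r.
  apply: (ler_wpM2r (ltW r0)); rewrite -mulrA ler_wpM2l//.
  apply: (le_trans (ler_norm _)); rewrite normrM (ger0_norm m0).
  by rewrite ler_piMr.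
have h3 : 0 <= 2 * al * m * r by rewrite !mulr_ge0// (ltW r0).
have h4 : 4 * r ^+ 2 <= 2 * r.
  by rewrite expr2 mulrA; apply: (ler_wpM2r (ltW r0)); lra.
by lra.
Qed.

Variables (n : nat) (al : R).

(** The data produced by a stable radial profile u: z is - u', g the source term
of the equation, c the coefficient of the linearized equation, and w a positive
radially decreasing function with - Laplacian of w = G >= c w, whose existence
encodes stability. The constant C may depend on the profile. *)
Record stable_radial_data (u z g c w W1 G : R -> R) (C : R) : Prop := {
  srd_u : forall r : R, 0 < r < 1 -> is_derive r 1 u (- z r);
  srd_z : forall r : R, 0 < r < 1 -> is_derive r 1 z (g r - n%:R * z r / r);
  srd_g : forall r : R, 0 < r < 1 ->
    is_derive r 1 g (al * g r / r - c r * z r);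
  srd_w : forall r : R, 0 < r < 1 -> is_derive r 1 w (W1 r);
  srd_W : forall r : R, 0 < r < 1 ->
    is_derive r 1 W1 (- n%:R * W1 r / r - G r);
  srd_sign : forall r : R, 0 < r < 1 ->
    [/\ 0 < w r, W1 r <= 0, c r * w r <= G r, 0 <= g r & 0 <= z r <= C * r]
}.

Section energy.
Variables (u z g c w W1 G : R -> R) (C b : R).
Hypothesis al0 : 0 <= al.
Hypothesis data : stable_radial_data u z g c w W1 G C.

Let y r := g r - n%:R * z r / r.

(** The boundary term of the stability inequality for w with the test function
z r^(-b) (1 - 2 r), after the second derivative of z has been eliminated through
the equation. *)
Definition energy r := r `^ (n%:R - 2 * b) * ((1 - 2 * r) ^+ 2 *
  (W1 r / w r * z r ^+ 2 - y r * z r + al / 2 * (z r ^+ 2 / r))).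

(** Picone's inequality says that the derivative is at most r^n z^2 times a
quadratic form in the cutoff; the cutoff contributes only terms of relative
size r, which are absorbed in the factor of r. *)
Lemma energy_derive_le : 0 < n%:R + al * (n%:R + 1) / 2 + al * b - b ^+ 2 ->
  exists dH : R -> R, forall r : R, 0 < r <= 1 / 2 ->
    is_derive r 1 energy (dH r) /\
    dH r <= r `^ (n%:R - 2 * b - 2) * z r ^+ 2 *
      (- (n%:R + al * (n%:R + 1) / 2 + al * b - b ^+ 2) +
       (4 * (n%:R + al * (n%:R + 1) / 2 + al * b - b ^+ 2) +
        4 * `|b| + 2) * r).
Proof.
move=> D0; set D := n%:R + al * (n%:R + 1) / 2 + al * b - b ^+ 2 in D0 *.
eexists => r r01.
have /andP[r0 r1] := r01.
have r01' : 0 < r < 1 by rewrite r0/=; lra.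
have rn0 : r != 0 by rewrite gt_eqF.
have [w0 W0 cG g0 /andP[z0 zC]] := srd_sign data r01'.
have wn0 : w r != 0 by rewrite gt_eqF.
have dz := srd_z data r01'.
have dg := srd_g data r01'.
have dw := srd_w data r01'.
have dW := srd_W data r01'.
have did := is_derive_id_fun r.
have dy : is_derive r 1 y (al * g r / r - c r * z r -
    (n%:R * y r * r - n%:R * z r) / r ^+ 2).
  apply: is_derive_eq (is_deriveB_fun dg (is_derive_div_fun rn0
    (is_deriveZ_fun n%:R dz) did)) _.
  by rewrite /y; ring.
have dX := is_deriveD_fun (is_deriveB_fun
   (is_deriveM_fun (is_derive_div_fun wn0 dW dw) (is_derive_sqr_fun dz))
   (is_deriveM_fun dy dz))
   (is_deriveZ_fun (al / 2) (is_derive_div_fun rn0 (is_derive_sqr_fun dz) did)).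
have dm := is_deriveB_fun (is_derive_cst_fun 1 r) (is_deriveZ_fun 2 did).
have dH := is_deriveM_fun (is_derive_powR_fun (n%:R - 2 * b) r0)
  (is_deriveM_fun (is_derive_sqr_fun dm) dX).
split; first exact: dH.
have q0 : 0 <= r `^ (n%:R - 2 * b) by exact: powR_ge0.
have gE : g r = y r + n%:R * z r / r by rewrite /y subrK.
have := @picone_inequality R n%:R al b r (r `^ (n%:R - 2 * b)) (z r) (w r)
  (W1 r) (y r) (c r) (G r) r0 w0 q0 cG.
lazy zeta; rewrite -gE => Hle.
apply: le_trans; last first.
  apply: (ler_wpM2l _ (quadratic_form_bound (K := n%:R + al * (n%:R + 1) / 2)
    al0 r01 D0)).
  by rewrite mulr_ge0 ?powR_ge0 ?sqr_ge0.
have -> : r `^ (n%:R - 2 * b - 2) = r `^ (n%:R - 2 * b) / r ^+ 2.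
  rewrite powRB; last by rewrite rn0 implybT.
  by rewrite -(powR_mulrn 2) ?ltW.
move: Hle; rewrite [X in _ <= X -> _](_ : _ = r `^ (n%:R - 2 * b) / r ^+ 2 *
  z r ^+ 2 * ((b * (1 - 2 * r) + 2 * r) ^+ 2 -
     al * (1 - 2 * r) * (b * (1 - 2 * r) + 2 * r) -
     (n%:R + al * (n%:R + 1) / 2) * (1 - 2 * r) ^+ 2)); last by field.
apply: le_trans; rewrite le_eqVlt; apply/orP; left; apply/eqP.
by rewrite /= -/(y r); field; rewrite ?rn0 ?wn0.
Qed.

End energy.

End stable_radial.

(** * The singularity estimate *)

Section stable_radial_bound.
Context {R : realType}.

(** Valid for both signs of s: the power is monotone on [d, 1] in either case. *)
Lemma powR_le_window (d x s : R) : 0 < d -> d <= x <= 1 ->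
  x `^ s <= d `^ s + 1.
Proof.
move=> d0 /andP[dx x1]; have x0 : 0 < x by exact: lt_le_trans dx.
have [s0|s0] := leP 0 s.
  have : x `^ s <= 1 `^ s by apply: ge0_ler_powR; rewrite ?nnegrE; lra.
  by rewrite powR1; have := powR_ge0 d s; lra.
have -> : s = - - s by rewrite opprK.
rewrite 2!(powRN _ (- s)); apply: ler_wpDr => //.
rewrite lef_pV2 ?posrE ?powR_gt0//.
by apply: ge0_ler_powR; rewrite ?nnegrE; lra.
Qed.

Lemma young_powR (x s z : R) : 0 < x ->
  z <= x `^ s * z ^+ 2 / 2 + x `^ (- s) / 2.
Proof.
move=> x0; rewrite powRN; have := powR_gt0 s x0; set t := x `^ s => t0.
rewrite -subr_ge0 [leRHS](_ : _ = (t * z - 1) ^+ 2 / (2 * t)).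
  by rewrite divr_ge0 ?sqr_ge0// mulr_ge0// ltW.
by field; rewrite gt_eqF.
Qed.

Lemma ge_of_slope (u z : R -> R) (B r t : R) : r <= t ->
  (forall x, r <= x <= t -> is_derive x 1 u (- z x)) ->
  (forall x, r <= x <= t -> z x <= B) ->
  u r <= u t + B * (t - r).
Proof.
move=> rt du zB.
have dB x : r <= x <= t -> is_derive x 1 (fun y => - B * y) (- B * 1).
  by move=> _; exact: (is_deriveZ_fun _ (is_derive_id_fun x)).
suff : - B * t - - B * r <= u t - u r by lra.
apply: (derive_le_le rt dB du) => x /zB zxB.
by rewrite mulr1 lerN2.
Qed.

Section decay.
Variables (n : nat) (al : R).
Variables (u z g c w W1 G : R -> R) (C b : R).
Hypothesis al0 : 0 <= al.
Hypothesis data : stable_radial_data n al u z g c w W1 G C.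
Local Notation H := (energy n al z g w W1 b).

Let inside (x : R) : 0 < x <= 1 / 2 -> 0 < x < 1.
Proof. by move=> /andP[-> x1]; lra. Qed.

Lemma energy_half : H (1 / 2) = 0.
Proof.
by rewrite /energy (_ : 1 - 2 * (1 / 2) = 0) ?expr0n/= ?mul0r ?mulr0//; lra.
Qed.

(** Only the term in W1 / w cannot be bounded by z, and it is nonpositive since w
decreases. The others are quadratic in z <= C r. *)
Lemma energy_upper (x : R) : 0 < x <= 1 / 2 ->
  H x <= (n%:R + al / 2) * C ^+ 2 * x `^ (n%:R - 2 * b + 1).
Proof.
move=> /[dup] x01 /andP[x0 x1].
have [w0 W0 cG g0 /andP[z0 zC]] := srd_sign data (inside x01).
have k0 : 0 <= n%:R + al / 2 by rewrite addr_ge0// divr_ge0.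
have -> : x `^ (n%:R - 2 * b + 1) = x `^ (n%:R - 2 * b) * x.
  rewrite (powRD (r := n%:R - 2 * b)) ?(powRr1 (ltW x0))//.
  by rewrite (gt_eqF x0) implybT.
rewrite /energy [leRHS]mulrCA.
apply: ler_wpM2l; first exact: powR_ge0.
have N0 : 0 <= z x ^+ 2 / x by rewrite divr_ge0 ?sqr_ge0// ltW.
have N1 := mulr_ge0 k0 N0.
apply: (@le_trans _ _ ((n%:R + al / 2) * (z x ^+ 2 / x))).
  have m1 : (1 - 2 * x) ^+ 2 <= 1.
    by rewrite -[leRHS](expr1n _ 2) lerXn2r ?nnegrE//; lra.
  apply: le_trans (_ : (1 - 2 * x) ^+ 2 * ((n%:R + al / 2) * (z x ^+ 2 / x)) <= _).
    apply: ler_wpM2l; first exact: sqr_ge0.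
    have h1 : W1 x / w x * z x ^+ 2 <= 0.
      by rewrite mulr_le0_ge0 ?sqr_ge0// mulr_le0_ge0// invr_ge0 ltW.
    have h2 : - ((g x - n%:R * z x / x) * z x) <= n%:R * (z x ^+ 2 / x).
      by have := mulr_ge0 g0 z0; lra.
    by move: h1 h2; lra.
  by rewrite -[leRHS]mul1r ler_wpM2r.
rewrite -[_ * C ^+ 2 * x]mulrA; apply: ler_wpM2l => //.
rewrite ler_pdivrMr// -mulrA -expr2 -exprMn lerXn2r ?nnegrE//.
exact: le_trans zC.
Qed.

Section coercive.
Let D := n%:R + al * (n%:R + 1) / 2 + al * b - b ^+ 2.
Let E := 4 * D + 4 * `|b| + 2.
Let s := n%:R - 2 * b - 2.
Variable d : R.
Hypotheses (D0 : 0 < D) (d0 : 0 < d) (d1 : d <= 1 / 2) (Ed : E * d <= D / 2).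

Let E0 : 0 <= E.
Proof.
by rewrite /E addr_ge0// addr_ge0// mulr_ge0// ltW.
Qed.

(** The energy vanishes at 1/2 and can only have grown at a controlled rate
since d, because on [d, 1/2] every factor of its derivative bound is bounded. *)
Lemma energy_lower (Z : R) : 0 <= Z -> (forall x, d <= x <= 1 / 2 -> z x <= Z) ->
  - H d <= (d `^ s + 1) * Z ^+ 2 * E.
Proof.
move=> Z0 zZ; set C2 := _ * E.
have [dH HdH] := energy_derive_le al0 data D0.
have C20 : 0 <= C2.
  by rewrite /C2 mulr_ge0// mulr_ge0 ?sqr_ge0// addr_ge0// powR_ge0.
have : H (1 / 2) - H d <= C2 * (1 / 2) - C2 * d.
  apply: (derive_le_le d1 (df := dH) (dg := fun=> C2 * 1)) => [x|x].
    by move=> /andP[dx x1]; apply: (HdH x _).1; rewrite x1 (lt_le_trans d0).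
  move=> /[dup] /zZ zx /andP[dx x1].
  have x0 : 0 < x by exact: lt_le_trans dx.
  have x01 : 0 < x <= 1 / 2 by rewrite x0.
  have [_ _ _ _ /andP[z0 _]] := srd_sign data (inside x01).
  apply: (le_trans (HdH x x01).2); rewrite mulr1 /C2 -/D -/E -/s.
  apply: (@le_trans _ _ (x `^ s * z x ^+ 2 * E)).
    apply: ler_wpM2l; first by rewrite mulr_ge0 ?powR_ge0 ?sqr_ge0.
    have : E * x <= E * 1 by apply: ler_wpM2l => //; lra.
    by move: D0; lra.
  apply: ler_wpM2r => //; apply: ler_pM; rewrite ?powR_ge0 ?sqr_ge0//.
    by apply: powR_le_window => //; rewrite dx; lra.
  by rewrite lerXn2r ?nnegrE.
rewrite energy_half.
have : C2 * (1 / 2 - d) <= C2 * 1.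
  by apply: ler_wpM2l => //; move: d0; lra.
by lra.
Qed.

(** Below d the energy loses at least half of D r^s z^2, and Young's inequality
trades r^s z^2 for z at the cost of r^(-s), which is integrable as s < 1. *)
Lemma solution_near_origin (x : R) : s < 1 -> 0 < x <= d ->
  u x <= u d + (H x - H d) / D + d `^ (1 - s) / (2 * (1 - s)).
Proof.
move=> s1 /andP[x0 xd].
have [dH HdH] := energy_derive_le al0 data D0.
pose k := (2 * (1 - s))^-1.
have k0 : 0 <= k by rewrite /k invr_ge0; lra.
(* the three terms balance by Young's inequality for z = y^(s/2) z y^(-s/2) *)
have : H d / D - u d - k * d `^ (1 - s) <= H x / D - u x - k * x `^ (1 - s).
  apply: (derive_le0_le (f := fun y => H y / D - u y - k * y `^ (1 - s))
    (df := fun y => D^-1 * dH y - (- z y) - k * ((1 - s) * y `^ (1 - s) / y)) xd).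
    move=> y /andP[xy yd]; have y0 : 0 < y by exact: lt_le_trans xy.
    have y01 : 0 < y <= 1 / 2 by rewrite y0 (le_trans yd).
    have dHy := (HdH y y01).1; have duy := srd_u data (inside y01).
    have -> : (fun y => H y / D - u y - k * y `^ (1 - s)) =
        (fun y => D^-1 * H y - u y - k * y `^ (1 - s)).
      by apply/funext => t; rewrite mulrC.
    exact: is_deriveB_fun (is_deriveB_fun (is_deriveZ_fun _ dHy) duy)
      (is_deriveZ_fun _ (is_derive_powR_fun _ y0)).
  move=> y /andP[xy yd]; have y0 : 0 < y by exact: lt_le_trans xy.
  have y01 : 0 < y <= 1 / 2 by rewrite y0 (le_trans yd).
  have -> : k * ((1 - s) * y `^ (1 - s) / y) = y `^ (- s) / 2.
    rewrite (powRD (r := 1)); last by rewrite (gt_eqF y0) implybT.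
    rewrite powRr1 ?ltW// /k; field.
    by rewrite (gt_eqF y0)/= subr_eq0 gt_eqF.
  have hd : D^-1 * dH y <= - (y `^ s * z y ^+ 2 / 2).
    rewrite mulrC ler_pdivrMr//; apply: (le_trans (HdH y y01).2).
    rewrite -/D -/E -/s.
    have h : - D + E * y <= - (D / 2).
      have : E * y <= E * d by apply: ler_wpM2l.
      by move: Ed; lra.
    have p0 : 0 <= y `^ s * z y ^+ 2 by rewrite mulr_ge0 ?powR_ge0 ?sqr_ge0.
    by have := ler_wpM2l p0 h; lra.
  by move: hd (young_powR s (z y) y0); lra.
have e1 : 0 <= k * x `^ (1 - s) by rewrite mulr_ge0 ?powR_ge0.
have -> : d `^ (1 - s) / (2 * (1 - s)) = k * d `^ (1 - s) by rewrite mulrC.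
by move: e1; lra.
Qed.

(** The previous bounds, summed. The energy at x tends to a nonpositive limit at 0,
with a rate that depends on the profile through C, but the limit does not. *)
Lemma solution_bound (A r : R) : s < 1 -> 0 < n%:R - 2 * b + 1 -> 0 <= A ->
  (forall x, 0 < x <= 1 / 2 -> z x * x ^+ n <= A) -> 0 < r <= 1 / 2 ->
  u r <= u (1 / 2) + (A / d ^+ n +
    (d `^ s + 1) * (A / d ^+ n) ^+ 2 * E / D + d `^ (1 - s) / (2 * (1 - s))).
Proof.
move=> s1; set p := n%:R - 2 * b + 1 => p0 A0 zA /[dup] r01 /andP[r0 r1].
pose Z := A / d ^+ n; have Z0 : 0 <= Z by rewrite divr_ge0// exprn_ge0// ltW.
have zZ x : d <= x <= 1 / 2 -> z x <= Z.
  move=> /andP[dx x1]; have x0 : 0 < x by exact: lt_le_trans dx.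
  have x01 : 0 < x <= 1 / 2 by rewrite x0.
  have [_ _ _ _ /andP[z0 _]] := srd_sign data (inside x01).
  rewrite ler_pdivlMr ?exprn_gt0//; apply: le_trans (zA x x01).
  by rewrite ler_wpM2l// lerXn2r ?nnegrE// ltW.
have Hd := energy_lower Z0 zZ.
have ud : u d <= u (1 / 2) + Z.
  have : u d <= u (1 / 2) + Z * (1 / 2 - d).
    apply: ge_of_slope d1 _ zZ => x /andP[dx x1]; apply: (srd_u data).
    by apply: inside; rewrite x1 (lt_le_trans d0).
  have : Z * (1 / 2 - d) <= Z * 1 by apply: ler_wpM2l => //; move: d0; lra.
  by lra.
pose L := u (1 / 2) + (Z + (d `^ s + 1) * Z ^+ 2 * E / D + d `^ (1 - s) / (2 * (1 - s))).
pose M := (n%:R + al / 2) * C ^+ 2 / D.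
suff limsup x : 0 < x -> x <= d -> x <= r -> u r - L <= M * x `^ p.
  have cv : M * x `^ p @[x --> 0^'+] --> M * 0.
    by apply: cvgM; [exact: cvg_cst|exact: powR_cvg0].
  rewrite -/Z -/L -subr_le0 -(mulr0 M); apply: (cvgr_to_ge cv); near=> x.
  apply: limsup; first by near: x; exact: nbhs_right_gt.
    by near: x; exact: nbhs_right_le.
  by near: x; exact: nbhs_right_le.
move=> x0 xd xr.
have uxr : u r <= u x.
  apply: (derive_le0_le (df := fun y => - z y) xr) => y /andP[xy yr].
    apply: (srd_u data); apply: inside.
    by rewrite (lt_le_trans x0 xy) (le_trans yr).
  have y01 : 0 < y <= 1 / 2 by rewrite (lt_le_trans x0 xy) (le_trans yr).
  by have [_ _ _ _ /andP[z0 _]] := srd_sign data (inside y01); rewrite oppr_le0.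
have H1 : H x / D <= M * x `^ p.
  rewrite /M [leRHS]mulrAC ler_pM2r ?invr_gt0//; apply: energy_upper.
  by rewrite x0 (le_trans xd).
have H3 : - H d / D <= (d `^ s + 1) * Z ^+ 2 * E / D by rewrite ler_pM2r ?invr_gt0.
have x0d : 0 < x <= d by rewrite x0.
have := solution_near_origin s1 x0d.
rewrite /L mulrBl; move: uxr ud H1 H3; rewrite mulNr.
move: (H x / D) (H d / D) (_ * E / D) (_ / (2 * (1 - s))) => a1 a2 a3 a4.
lra.
Unshelve. all: by end_near. Qed.

End coercive.

End decay.

(** The bound depends on the profile only through the value at 1/2 and the bound A
on the flux r^n z, which is what makes it uniform. *)
Lemma stable_radial_bound (n : nat) (al A : R) :
  0 <= al -> n.+1%:R < 10 + 4 * al -> 0 <= A ->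
  exists C', forall (u z g c w W1 G : R -> R) (C : R),
    stable_radial_data n al u z g c w W1 G C ->
    (forall r, 0 < r <= 1 / 2 -> z r * r ^+ n <= A) ->
    forall r, 0 < r <= 1 / 2 -> u r <= u (1 / 2) + C'.
Proof.
move=> al0 nal A0.
case: (posnP n) => [n0|n0].
  (* in dimension one the moment bound already controls u' *)
  exists A => u z g c w W1 G C data zA r /andP[r0 r1].
  have : u r <= u (1 / 2) + A * (1 / 2 - r).
    apply: (@ge_of_slope u z) => //.
      by move=> x /andP[rx x1]; apply: (srd_u data); lra.
    move=> x /andP[rx x1]; have := zA x; rewrite n0 expr0 mulr1; apply; lra.
  have : A * (1 / 2 - r) <= A * 1 by rewrite ler_wpM2l//; lra.
  by lra.
have [b [b1 b2 b3]] := exponent_window n0 al0 nal.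
pose D := n%:R + al * (n%:R + 1) / 2 + al * b - b ^+ 2.
have D0 : 0 < D by rewrite /D; move: b3; rewrite -natr1; lra.
pose E := 4 * D + 4 * `|b| + 2.
have E0 : 4 * D + 2 <= E by rewrite /E; have := normr_ge0 b; lra.
(* below d the coercive term dominates, as E d = D / 2 *)
pose d := D / (2 * E).
have d0 : 0 < d by rewrite divr_gt0//; lra.
have dE : E * d <= D / 2 by rewrite le_eqVlt; apply/orP; left; rewrite /d; apply/eqP; field; apply/eqP; lra.
have d1 : d <= 1 / 2 by rewrite /d ler_pdivrMr; lra.
have s1 : n%:R - 2 * b - 2 < 1 by lra.
have p0 : 0 < n%:R - 2 * b + 1 by lra.
eexists => u z g c w W1 G C data zA r r01.
exact: (solution_bound al0 data D0 d0 d1 dE s1 p0 A0 zA r01).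
Qed.

End stable_radial_bound.

(** * Primitives and bounded convergence *)

Section bounded_convergence.
Context d (T : measurableType d) (R : realType).
Variables (mu : {measure set T -> \bar R}) (D : set T).
Hypotheses (mD : measurable D) (Doo : (mu D < +oo)%E).

Lemma bounded_integrable (f : T -> R) (K : R) :
  measurable_fun D f -> {ae mu, forall x, D x -> `|f x| <= K} ->
  mu.-integrable D (EFin \o f).
Proof.
move=> mf fK; apply/integrableP; split; first exact/measurable_EFinP.
apply: (@le_lt_trans _ _ (\int[mu]_(x in D) (cst `|K|%:E) x)%E).
  apply: ae_ge0_le_integral => //.
  - by apply: measurableT_comp => //; exact/measurable_EFinP.
  - by move=> x _; rewrite /= lee_fin.
  - move: fK; apply: filterS => x fK Dx /=.
    by rewrite lee_fin (le_trans (fK Dx))// ler_norm.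
rewrite integral_cst// lte_mul_pinfty ?lee_fin//.
Qed.

Lemma bounded_cvg_Rintegral (f_ : nat -> T -> R) (f : T -> R) (K : R) :
  (forall k, measurable_fun D (f_ k)) -> measurable_fun D f ->
  (forall k, {ae mu, forall x, D x -> `|f_ k x| <= K}) ->
  {ae mu, forall x, D x -> f_ ^~ x @ \oo --> f x} ->
  (\int[mu]_(x in D) f_ k x)%R @[k --> \oo] --> (\int[mu]_(x in D) f x)%R.
Proof.
move=> mf_ mf fK ff.
have fK' : {ae mu, forall x k, D x -> (`|(EFin \o f_ k) x| <= (cst K%:E) x)%E}.
  apply/ae_foralln => k; move: (fK k); apply: filterS => x h Dx.
  by rewrite /= lee_fin; exact: h.
have [| | | |If _ cf] := @dominated_convergence _ _ _ mu D mD
  (fun k => EFin \o f_ k) (EFin \o f) (cst K%:E) _ _ _ _ fK'.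
- by move=> k; exact/measurable_EFinP.
- exact/measurable_EFinP.
- move: ff; apply: filterS => x h Dx /=.
  by apply: cvg_EFin; [exact: nearW|exact: h].
- by apply: (@bounded_integrable (cst K) `|K|) => //; apply: aeW.
apply: fine_cvg; rewrite fineK; last exact: integrable_fin_num.
exact: cf.
Qed.

End bounded_convergence.

Section primitive.
Context {R : realType}.
Implicit Types f g : R -> R.

(** The base point -1 makes the derivative at 0 two-sided. *)
Definition prim f (x : R) : R := (\int[@lebesgue_measure R]_(t in `[-1, x]) f t)%R.

Lemma prim_derive f (x : R) : continuous f -> -1 < x ->
  is_derive x 1 (prim f) (f x).
Proof.
move=> cf x1.
have fi : (@lebesgue_measure R).-integrable `[-1, x + 1] (EFin \o f).
  apply: continuous_compact_integrable; first exact: segment_compact.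
  exact: continuous_subspaceT.
have [df dE] := @continuous_FTC1_closed R f (-1) x (x + 1)
  (ltr_pwDr ltr01 (lexx x)) fi x1 (cf x).
by split; [exact: df|rewrite -derive1E; exact: dE].
Qed.

Lemma prim_cvg (f_ : nat -> R -> R) f (K x : R) :
  (forall k, continuous (f_ k)) -> continuous f ->
  (forall k t, -1 <= t <= x -> `|f_ k t| <= K) ->
  (forall t, -1 <= t <= x -> f_ ^~ t @ \oo --> f t) ->
  prim (f_ k) x @[k --> \oo] --> prim f x.
Proof.
move=> cf_ cf fK ff; rewrite /prim.
apply: (@bounded_cvg_Rintegral _ _ _ (@lebesgue_measure R) `[-1, x]%classic).
- by [].
- rewrite /= lebesgue_measure_itv /=; case: ifPn => _; rewrite ?ltry//.
- by move=> k; apply: measurable_funTS; exact: continuous_measurable_fun.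
- by apply: measurable_funTS; exact: continuous_measurable_fun.
- by move=> k; apply: aeW => t /=; rewrite in_itv/=; exact: fK.
- by apply: aeW => t /=; rewrite in_itv/=; exact: ff.
Qed.

End primitive.

(** * Radial solutions of the Poisson equation on a half-line *)

Section radial_potential.
Context {R : realType}.
Variable n : nat.
Implicit Types g : R -> R.

Let N0 : 0 < n.+1%:R :> R. Proof. by rewrite ltr0n. Qed.

(** For the radial solution psi of - Laplacian psi = g in dimension n + 1 that
vanishes on the unit sphere, [flux] is - r^n psi'(r), [slope] is - psi'(r) / r,
extended by its limit at the origin, and [potential] is psi as a function of
the squared radius. That variable makes the composition with |x|^2
differentiable at the origin without a case distinction. *)
Definition flux g (r : R) : R :=
  prim (fun s => s ^+ n * g s) r - prim (fun s => s ^+ n * g s) 0.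

Definition slope g (r : R) : R :=
  if 0 < r then flux g r / r ^+ n.+1 else g 0 / n.+1%:R.

Definition potential g (rho : R) : R :=
  (prim (slope g \o Num.sqrt) 1 - prim (slope g \o Num.sqrt) rho) / 2.

Lemma flux0 g : flux g 0 = 0. Proof. by rewrite /flux subrr. Qed.

Lemma flux_derive g (r : R) : continuous g -> 0 <= r ->
  is_derive r 1 (flux g) (r ^+ n * g r).
Proof.
move=> cg r0; rewrite -[X in is_derive _ _ _ X]subr0.
have r1 : -1 < r by lra.
have cf : continuous (fun s : R => s ^+ n * g s).
  by move=> x; apply: cvgM; [exact: exprn_continuous|exact: cg].
exact: is_deriveB_fun (prim_derive cf r1) (is_derive_cst_fun _ r).
Qed.

Let powN_derive (a r : R) :
  is_derive r 1 (fun x => a / n.+1%:R * x ^+ n.+1) (r ^+ n * a).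
Proof.
apply: is_derive_eq (is_deriveZ_fun _ (is_derive_exprn_fun _ _)) _.
by rewrite succnK mulrA divfK ?gt_eqF// mulrC.
Qed.

(** The slope is a weighted mean of g over [0, r], divided by n + 1. *)
Lemma slope_le g (a r : R) : continuous g -> 0 <= r ->
  (forall s, 0 <= s <= r -> g s <= a) -> slope g r <= a / n.+1%:R.
Proof.
move=> cg r0 ga; rewrite /slope; case: ifPn => [r1|_]; last first.
  by rewrite ler_pM2r ?invr_gt0// ga// lexx.
rewrite ler_pdivrMr ?exprn_gt0//.
have := @derive_le_le R (flux g) (fun x => a / n.+1%:R * x ^+ n.+1)
  (fun x => x ^+ n * g x) (fun x => x ^+ n * a) 0 r r0.
rewrite flux0 expr0n/= mulr0 !subr0; apply.
- by move=> x /andP[x0 _]; exact: flux_derive.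
- by move=> x _; exact: powN_derive.
- by move=> x /[dup] /andP[x0 _] /ga h; rewrite ler_wpM2l// exprn_ge0.
Qed.

Lemma slope_ge g (a r : R) : continuous g -> 0 <= r ->
  (forall s, 0 <= s <= r -> a <= g s) -> a / n.+1%:R <= slope g r.
Proof.
move=> cg r0 ga; rewrite /slope; case: ifPn => [r1|_]; last first.
  by rewrite ler_pM2r ?invr_gt0// ga// lexx.
rewrite ler_pdivlMr ?exprn_gt0//.
have := @derive_le_le R (fun x => a / n.+1%:R * x ^+ n.+1) (flux g)
  (fun x => x ^+ n * a) (fun x => x ^+ n * g x) 0 r r0.
rewrite flux0 expr0n/= mulr0 !subr0; apply.
- by move=> x _; exact: powN_derive.
- by move=> x /andP[x0 _]; exact: flux_derive.
- by move=> x /[dup] /andP[x0 _] /ga h; rewrite ler_wpM2l// exprn_ge0.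
Qed.

Lemma flux_le g1 g2 (r : R) : continuous g1 -> continuous g2 -> 0 <= r ->
  (forall s, 0 <= s <= r -> g1 s <= g2 s) -> flux g1 r <= flux g2 r.
Proof.
move=> cg1 cg2 r0 g12.
have := @derive_le_le R (flux g1) (flux g2)
  (fun x => x ^+ n * g1 x) (fun x => x ^+ n * g2 x) 0 r r0.
rewrite !flux0 !subr0; apply.
- by move=> x /andP[x0 _]; exact: flux_derive.
- by move=> x /andP[x0 _]; exact: flux_derive.
- by move=> x /[dup] /andP[x0 _] /g12 h; rewrite ler_wpM2l// exprn_ge0.
Qed.

Lemma slope_mono g1 g2 (r : R) : continuous g1 -> continuous g2 -> 0 <= r ->
  (forall s, 0 <= s <= r -> g1 s <= g2 s) -> slope g1 r <= slope g2 r.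
Proof.
move=> cg1 cg2 r0 g12; rewrite /slope; case: ifPn => [r1|_]; last first.
  by rewrite ler_pM2r ?invr_gt0// g12// lexx.
by rewrite ler_pM2r ?invr_gt0 ?exprn_gt0// flux_le.
Qed.

Lemma slope_derive g (r : R) : continuous g -> 0 < r ->
  is_derive r 1 (slope g) ((g r - n.+1%:R * slope g r) / r).
Proof.
move=> cg r0.
have rn0 : r != 0 by rewrite gt_eqF.
apply: (@near_eq_is_derive _ _ _ (fun x => flux g x / x ^+ n.+1)) => //.
  near=> x; rewrite /slope ifT//; near: x; exact: lt_nbhsr.
have rN0 : r ^+ n.+1 != 0 by rewrite expf_neq0.
apply: is_derive_eq (is_derive_div_fun (g := fun y => y ^+ n.+1) (x := r) rN0
  (flux_derive cg (ltW r0)) (is_derive_exprn_fun n.+1 r)) _.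
rewrite /slope r0 succnK exprS; field.
by rewrite rn0 expf_neq0.
Unshelve. all: by end_near. Qed.

Lemma slope_continuous g : continuous g -> continuous (slope g).
Proof.
move=> cg r; have [r0|r0|->] := ltgtP r 0.
- apply: is_derive_continuous
    (near_eq_is_derive _ (is_derive_cst_fun (g 0 / n.+1%:R) r)).
  near=> x; rewrite /slope ifF//; apply/negbTE; rewrite -leNgt ltW//.
  near: x; exact: lt_nbhsl.
- exact: is_derive_continuous (slope_derive cg r0).
- apply/cvgrPdist_le => e e0.
  have /cvgrPdist_le/(_ _ e0)[d/= d0 Hd] := cg 0.
  near=> x; rewrite {1}/slope ltxx.
  have [x0|x0] := leP x 0; first by rewrite /slope ltNge x0/= subrr normr0 ltW.
  have xd : x < d.
    near: x; exact: lt_nbhsl.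
  have gb s : 0 <= s <= x -> `|g 0 - g s| <= e.
    move=> /andP[s0 sx]; apply: Hd => /=.
    by rewrite sub0r normrN ger0_norm//; lra.
  have h1 : slope g x <= (g 0 + e) / n.+1%:R.
    by apply: slope_le => //; [exact: ltW|move=> s /gb; rewrite ler_norml; lra].
  have h2 : (g 0 - e) / n.+1%:R <= slope g x.
    by apply: slope_ge => //; [exact: ltW|move=> s /gb; rewrite ler_norml; lra].
  have h3 : e / n.+1%:R <= e.
    by rewrite ler_pdivrMr// ler_peMr ?ler1n// ltW.
  move: h1 h2 h3; rewrite mulrDl mulrBl ler_norml.
  move: (g 0 / _) (e / _) => a b; lra.
Unshelve. all: by end_near. Qed.

Let slope_sqrt_continuous g : continuous g -> continuous (slope g \o Num.sqrt).
Proof.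
move=> cg x; apply: continuous_comp; first exact: sqrt_continuous.
exact: slope_continuous.
Qed.

Lemma potential_derive g (rho : R) : continuous g -> -1 < rho ->
  is_derive rho 1 (potential g) (- slope g (Num.sqrt rho) / 2).
Proof.
move=> cg r0; rewrite /potential.
have := is_deriveZ_fun 2^-1 (is_deriveB_fun
  (is_derive_cst_fun (prim (slope g \o Num.sqrt) 1) rho)
  (prim_derive (slope_sqrt_continuous cg) r0)).
rewrite sub0r /= mulrC; congr is_derive.
by apply/funext => x; rewrite mulrC.
Qed.

Lemma potential1 g : potential g 1 = 0.
Proof. by rewrite /potential subrr mul0r. Qed.

Lemma radial_derive g (r : R) : continuous g -> 0 <= r ->
  is_derive r 1 (fun x => potential g (x ^+ 2)) (- (r * slope g r)).
Proof.
move=> cg r0.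
have h : -1 < r ^+ 2 by have := sqr_ge0 r; lra.
have := @is_derive1_comp R (potential g) (fun x => x ^+ 2) r _ _
  (potential_derive cg h) (is_derive_sqr_fun (is_derive_id_fun r)).
rewrite sqrtr_sqr ger0_norm// => H; apply: is_derive_eq H _.
by field.
Qed.

Lemma slope_ge0 g (r : R) : continuous g -> 0 <= r ->
  (forall s, 0 <= s <= r -> 0 <= g s) -> 0 <= slope g r.
Proof. by move=> cg r0 g0; have := slope_ge cg r0 g0; rewrite mul0r. Qed.

Lemma potential_antitone g (s t : R) : continuous g ->
  (forall x, 0 <= x <= 1 -> 0 <= g x) -> 0 <= s -> s <= t -> t <= 1 ->
  potential g (t ^+ 2) <= potential g (s ^+ 2).
Proof.
move=> cg g0 s0 st t1.
apply: (@derive_le0_le R (fun x => potential g (x ^+ 2))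
   (fun x => - (x * slope g x))) => //.
  by move=> x /andP[sx xt]; apply: radial_derive => //; lra.
move=> x /andP[sx xt]; rewrite oppr_le0 mulr_ge0//; first by lra.
by apply: slope_ge0 => //; [lra|move=> y ?; apply: g0; lra].
Qed.

Lemma potential_ge0 g (r : R) : continuous g ->
  (forall x, 0 <= x <= 1 -> 0 <= g x) -> 0 <= r <= 1 ->
  0 <= potential g (r ^+ 2).
Proof.
move=> cg g0 /andP[r0 r1]; rewrite -(potential1 g) -[X in potential g X](expr1n _ 2).
exact: potential_antitone.
Qed.

Lemma potential_mono g1 g2 (r : R) : continuous g1 -> continuous g2 ->
  (forall x, 0 <= x <= 1 -> g1 x <= g2 x) -> 0 <= r <= 1 ->
  potential g1 (r ^+ 2) <= potential g2 (r ^+ 2).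
Proof.
move=> cg1 cg2 g12 /andP[r0 r1].
have := @derive_le_le R (fun x => potential g2 (x ^+ 2))
  (fun x => potential g1 (x ^+ 2))
  (fun x => - (x * slope g2 x)) (fun x => - (x * slope g1 x)) r 1 r1.
rewrite !expr1n !potential1 !sub0r lerN2; apply.
- by move=> x /andP[rx _]; apply: radial_derive => //; lra.
- by move=> x /andP[rx _]; apply: radial_derive => //; lra.
move=> x /andP[rx x1]; rewrite lerN2; apply: ler_wpM2l; first by lra.
by apply: slope_mono => //; [lra|move=> s ?; apply: g12; lra].
Qed.

Lemma slope_bound g (K r : R) : continuous g -> 0 <= r ->
  (forall s, 0 <= g s <= K) -> 0 <= slope g r <= K.
Proof.
move=> cg r0 gK; apply/andP; split.
  by apply: slope_ge0 => // s _; case/andP: (gK s).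
apply: (le_trans (slope_le (a := K) cg r0 _)).
  by move=> s _; case/andP: (gK s).
have /andP[g0 g1] := gK 0; have K0 : 0 <= K by exact: le_trans g1.
by rewrite ler_pdivrMr// ler_peMr ?ler1n.
Qed.

Lemma potential_lipschitz g (K s t : R) : continuous g ->
  (forall x, 0 <= g x <= K) -> 0 <= s -> s <= t -> t <= 1 ->
  `|potential g (s ^+ 2) - potential g (t ^+ 2)| <= K * (t - s).
Proof.
move=> cg gK s0 st t1.
rewrite ger0_norm; last first.
  by rewrite subr_ge0 potential_antitone// => x _; case/andP: (gK x).
have := @derive_le_le R (fun x => - K * x)
  (fun x => potential g (x ^+ 2)) (fun x => - K * 1)
  (fun x => - (x * slope g x)) s t st.
have h : (forall x : R, s <= x <= t -> is_derive x 1 (fun x => - K * x) (- K * 1)).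
  by move=> x _; exact: (is_deriveZ_fun _ (is_derive_id_fun x)).
move=> /(_ h) H; suff : - K * t - - K * s <=
  potential g (t ^+ 2) - potential g (s ^+ 2) by lra.
apply: H => x /andP[sx xt].
  by apply: radial_derive => //; lra.
have x0 : 0 <= x by lra.
have /andP[p0 pK] := slope_bound cg x0 gK.
rewrite mulr1 lerN2; apply: le_trans pK.
by rewrite ler_piMl//; lra.
Qed.

Lemma flux_cvg (g_ : nat -> R -> R) g (K r : R) :
  (forall k, continuous (g_ k)) -> continuous g ->
  (forall k t, `|g_ k t| <= K) -> (forall t, g_ ^~ t @ \oo --> g t) ->
  0 <= r <= 1 -> flux (g_ k) r @[k --> \oo] --> flux g r.
Proof.
move=> cg_ cg gK gg /andP[r0 r1].
have cM h : continuous h -> continuous (fun s : R => s ^+ n * h s).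
  by move=> ch x; apply: cvgM; [exact: exprn_continuous|exact: ch].
have H x : 0 <= x <= 1 -> prim (fun s => s ^+ n * g_ k s) x @[k --> \oo] -->
    prim (fun s => s ^+ n * g s) x.
  move=> /andP[x0 x1]; apply: (@prim_cvg R _ _ K).
  - by move=> k; exact: cM.
  - exact: cM.
  - move=> k t /andP[t0 t1]; rewrite normrM normrX.
    apply: le_trans (gK k t); rewrite ler_piMl// exprn_ile1//.
    by rewrite ler_norml; lra.
  - by move=> t _; apply: cvgM; [exact: cvg_cst|exact: gg].
by apply: cvgB; apply: H; lra.
Qed.

Lemma slope_cvg (g_ : nat -> R -> R) g (K r : R) :
  (forall k, continuous (g_ k)) -> continuous g ->
  (forall k t, `|g_ k t| <= K) -> (forall t, g_ ^~ t @ \oo --> g t) ->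
  r <= 1 -> slope (g_ k) r @[k --> \oo] --> slope g r.
Proof.
move=> cg_ cg gK gg r1; rewrite /slope; case: ifPn => [r0|_].
  apply: cvgM; last exact: cvg_cst.
  by apply: (flux_cvg cg_ cg gK gg); rewrite ltW.
by apply: cvgM; [exact: gg|exact: cvg_cst].
Qed.

(** Dominated convergence, once for the flux and once for the potential. *)
Lemma potential_cvg (g_ : nat -> R -> R) g (K r : R) :
  (forall k, continuous (g_ k)) -> continuous g ->
  (forall k t, 0 <= g_ k t <= K) -> (forall t, g_ ^~ t @ \oo --> g t) ->
  0 <= r <= 1 ->
  potential (g_ k) (r ^+ 2) @[k --> \oo] --> potential g (r ^+ 2).
Proof.
move=> cg_ cg gK gg /andP[r0 r1].
have gK' k t : `|g_ k t| <= K by have /andP[? ?] := gK k t; rewrite ger0_norm.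
have H x : 0 <= x <= 1 -> prim (slope (g_ k) \o Num.sqrt) x @[k --> \oo] -->
    prim (slope g \o Num.sqrt) x.
  move=> /andP[x0 x1]; apply: (@prim_cvg R _ _ K).
  - by move=> k; exact: slope_sqrt_continuous.
  - exact: slope_sqrt_continuous.
  - move=> k t _; have /andP[] := slope_bound (cg_ k) (sqrtr_ge0 t) (gK k).
    by move=> ? ?; rewrite /= ger0_norm.
  - move=> t /andP[_ t1]; apply: (slope_cvg cg_ cg gK' gg).
    by rewrite -[leRHS]sqrtr1 ler_wsqrtr//; lra.
apply: cvgM; last exact: cvg_cst.
by apply: cvgB; apply: H; rewrite ?ler01 ?lexx// sqr_ge0 expr_le1.
Qed.

End radial_potential.

Section potential_linear.
Context {R : realType}.
Variable n : nat.
Implicit Types g : R -> R.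

Lemma fluxB g1 g2 (r : R) : continuous g1 -> continuous g2 -> 0 <= r ->
  flux n (fun s => g1 s - g2 s) r = flux n g1 r - flux n g2 r.
Proof.
move=> c1 c2 r0.
have cB : continuous (fun s => g1 s - g2 s).
  by move=> s; apply: cvgB; [exact: c1|exact: c2].
have := @derive_eq_sub R (flux n (fun s => g1 s - g2 s))
  (fun r => flux n g1 r - flux n g2 r)
  (fun x => x ^+ n * (g1 x - g2 x)) 0 r r0.
rewrite !flux0 !subr0; apply.
  by move=> x /andP[x0 _]; exact: flux_derive.
move=> x /andP[x0 _].
apply: is_derive_eq (is_deriveB_fun (flux_derive n c1 x0) (flux_derive n c2 x0)) _.
by rewrite mulrBr.
Qed.

Lemma slopeB g1 g2 (r : R) : continuous g1 -> continuous g2 ->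
  slope n (fun s => g1 s - g2 s) r = slope n g1 r - slope n g2 r.
Proof.
move=> c1 c2; rewrite /slope; case: ifPn => [r0|_]; last by rewrite mulrBl.
by rewrite fluxB ?mulrBl// ltW.
Qed.

Lemma potentialB g1 g2 (r : R) : continuous g1 -> continuous g2 -> 0 <= r <= 1 ->
  potential n (fun s => g1 s - g2 s) (r ^+ 2) =
  potential n g1 (r ^+ 2) - potential n g2 (r ^+ 2).
Proof.
move=> c1 c2 /andP[r0 r1].
have cB : continuous (fun s => g1 s - g2 s).
  by move=> s; apply: cvgB; [exact: c1|exact: c2].
have := @derive_eq_sub R (fun x => potential n (fun s => g1 s - g2 s) (x ^+ 2))
  (fun x => potential n g1 (x ^+ 2) - potential n g2 (x ^+ 2))
  (fun x => - (x * slope n (fun s => g1 s - g2 s) x)) r 1 r1.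
rewrite expr1n !potential1 subrr !sub0r => H; apply: oppr_inj; apply: H.
  by move=> x /andP[rx _]; apply: radial_derive => //; lra.
move=> x /andP[rx _]; have x0 : 0 <= x by lra.
apply: is_derive_eq (is_deriveB_fun (radial_derive n c1 x0) (radial_derive n c2 x0)) _.
by rewrite slopeB//; ring.
Qed.

Lemma flux_nondecreasing g (s t : R) : continuous g ->
  (forall x, 0 <= x <= 1 -> 0 <= g x) -> 0 <= s -> s <= t -> t <= 1 ->
  flux n g s <= flux n g t.
Proof.
move=> cg g0 s0 st t1.
have : flux n g s - flux n g s <= flux n g t - flux n g s.
  rewrite subrr -[leLHS](subrr (0 : R)).
  apply: (@derive_le_le R (fun=> 0) (flux n g) (fun=> 0) (fun x => x ^+ n * g x)) => //.
    by move=> x /andP[sx _]; apply: flux_derive => //; lra.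
  move=> x /andP[sx xt]; rewrite mulr_ge0 ?exprn_ge0// ?g0//; lra.
by lra.
Qed.

(** Only the mass of g on [r / 2, r] is kept. Staying away from 0 avoids
differentiating the weight r^alpha there. *)
Lemma flux_lower g (a r : R) : continuous g ->
  (forall x, 0 <= x <= 1 -> 0 <= g x) -> 0 < r <= 1 -> 0 <= a ->
  (forall x, r / 2 <= x <= r -> a <= g x) ->
  a * (r / 2) ^+ n.+1 <= flux n g r.
Proof.
move=> cg g0 /andP[r0 r1] a0 ga.
have h2 : 0 <= flux n g (r / 2).
  by rewrite -(flux0 n g); apply: flux_nondecreasing => //; lra.
have : (a * (r / 2) ^+ n) * r - (a * (r / 2) ^+ n) * (r / 2) <=
    flux n g r - flux n g (r / 2).
  apply: (@derive_le_le R (fun x => a * (r / 2) ^+ n * x) (flux n g)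
    (fun=> a * (r / 2) ^+ n * 1) (fun x => x ^+ n * g x)) => //.
  - by lra.
  - by move=> x /andP[rx _]; apply: flux_derive => //; lra.
  move=> x /[dup] rx /andP[rx1 rx2]; rewrite mulr1 mulrC.
  apply: ler_pM => //; last exact: ga.
    by rewrite exprn_ge0//; lra.
  by rewrite lerXn2r ?nnegrE//; lra.
rewrite exprSr mulrA; lra.
Qed.

(** Beyond t the flux is at least its value at t, and r^(- n) >= 1 there. *)
Lemma flux_le_potential g (t : R) : continuous g ->
  (forall x, 0 <= x <= 1 -> 0 <= g x) -> 0 < t <= 1 ->
  flux n g t * (1 - t) <= potential n g (t ^+ 2).
Proof.
move=> cg g0 /andP[t0 t1].
have : potential n g (1 ^+ 2) - potential n g (t ^+ 2) <=
    - flux n g t * 1 - - flux n g t * t.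
  apply: (@derive_le_le R (fun x => potential n g (x ^+ 2))
    (fun x => - flux n g t * x) (fun x => - (x * slope n g x))
    (fun=> - flux n g t * 1)) => //.
  - by move=> x /andP[tx _]; apply: radial_derive => //; lra.
  move=> x /andP[tx x1]; have x0 : 0 < x by lra.
  rewrite mulr1 lerN2 /slope x0.
  have h : flux n g t <= flux n g x by apply: flux_nondecreasing => //; lra.
  have f0 : 0 <= flux n g x.
    by rewrite -(flux0 n g); apply: flux_nondecreasing => //; lra.
  apply: (le_trans h); rewrite mulrC exprSr invfM mulrA divfK ?gt_eqF//.
  rewrite ler_pdivlMr ?exprn_gt0// ler_piMr// exprn_ile1//; lra.
rewrite expr1n potential1; lra.
Qed.

Lemma moment_derive g (r : R) : continuous g -> 0 < r ->
  is_derive r 1 (fun x => x * slope n g x) (g r - n%:R * (r * slope n g r) / r).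
Proof.
move=> cg r0.
apply: is_derive_eq (is_deriveM_fun (is_derive_id_fun r) (slope_derive n cg r0)) _.
by rewrite -natr1; field; rewrite gt_eqF.
Qed.

End potential_linear.

(** * The Borel sets and the unit ball of R^N *)

Lemma measurable_box {R : realType} {N : nat}
    (A : 'I_N -> set (measurableTypeR R)) : (forall i, measurable (A i)) ->
  measurable [set x : 'rV[R]_N | forall i, A i (coord_rV i x)].
Proof.
move=> mA; rewrite (_ : mkset _ = \bigcap_(i in [set: 'I_N]) (coord_rV i @^-1` A i)).
  apply: fin_bigcap_measurable => // i _; rewrite -[X in measurable X]setTI.
  exact: measurable_coord_rV.
by apply/seteqP; split=> [x h i _|x h i]; [exact: h|exact: (h i)].
Qed.

Section borel_rV.
Context {R : realType} {N : nat}.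
Implicit Types (A : set 'rV[R]_N) (x y : 'rV[R]_N).

Let box (q : 'rV[rat]_N) (k : nat) : set 'rV[R]_N :=
  [set x | forall i, `|ratr (q ord0 i) - x ord0 i| < k.+1%:R^-1].

(** An open set is the union of the boxes with rational centre and half-side
1 / (k + 1) that it contains. *)
Lemma open_measurable_rV A : open A -> measurable A.
Proof.
move=> oA.
have mbox q k : measurable (box q k).
  apply: (@measurable_box R N (fun i => ball (ratr (q ord0 i) : R) k.+1%:R^-1)).
  by move=> i; exact: measurable_ball.
pose B (p : 'rV[rat]_N * nat) := if `[< box p.1 p.2 `<=` A >] then
  box p.1 p.2 else set0.
have -> : A = \bigcup_p B p.
  apply/seteqP; split => [x Ax|x [p _]]; last first.
    by rewrite /B; case: asboolP => // h /h.
  have /nbhs_ballP[e /= e0 xeA] : nbhs x A by exact: open_nbhs_nbhs.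
  have [k ke] : exists k : nat, k.+1%:R^-1 < e / 2.
    have e20 : 0 < e / 2 by rewrite divr_gt0.
    by have [k _ Hk] := near_infty_natSinv_lt (PosNum e20); exists k; exact: (Hk k (leqnn k)).
  have k0 : (0 : R) < k.+1%:R^-1 by rewrite invr_gt0.
  have hq i : exists q : rat, x ord0 i < ratr q < x ord0 i + k.+1%:R^-1.
    have [|q] := @rat_in_itvoo R (x ord0 i) (x ord0 i + k.+1%:R^-1).
      by rewrite ltrDl.
    by rewrite in_itv/= => h; exists q.
  have [q hq'] := choice hq.
  exists ((\row_i q i), k) => //; rewrite /B.
  have xb : box (\row_i q i) k x.
    move=> i; rewrite mxE; have := hq' i; rewrite ltr_norml.
    suff aux (a b c : R) : c < b < c + a -> - a < b - c < a by exact: aux.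
    by lra.
  case: asboolP => // -[] y yb; apply: xeA; split=> // j i.
  rewrite ord1 /ball /=.
  have /= := yb i; have := xb i; rewrite !mxE => h1 h2.
  rewrite (_ : x ord0 i - y ord0 i = (ratr (q i) - y ord0 i) - (ratr (q i) - x ord0 i)); last by ring.
  suff aux (a b c : R) : a < c -> b < c -> c < e / 2 -> a + b < e.
    by apply: (le_lt_trans (ler_normB _ _)); exact: aux h2 h1 ke.
  by lra.
apply: countable_bigcupT_measurable => [|p]; first exact: countableP.
by rewrite /B; case: ifP.
Qed.

Lemma closed_measurable_rV A : closed A -> measurable A.
Proof.
by move=> cA; rewrite -(setCK A); apply: measurableC; apply: open_measurable_rV;
  exact: closed_openC.
Qed.

Lemma within_continuous_measurable_rV A (f : 'rV[R]_N -> R) :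
  measurable A -> {within A, continuous f} -> measurable_fun A f.
Proof.
move=> mA /continuousP cf; apply: (measurability _ (RGenOpens.measurableE R)).
move=> _ [_ [a [b ->] <-]].
have oab : open (`]a, b[%classic : set R) by exact: interval_open.
have /open_subspaceP[V oV VA] := cf _ oab.
rewrite setIC -VA; apply: measurableI => //; exact: open_measurable_rV.
Qed.

Lemma continuous_measurable_rV A (f : 'rV[R]_N -> R) :
  measurable A -> continuous f -> measurable_fun A f.
Proof.
move=> mA cf; apply: within_continuous_measurable_rV => //.
exact: continuous_subspaceT.
Qed.

End borel_rV.

Section enorm.
Context {R : realType} {N : nat}.
Implicit Types x y : 'rV[R]_N.

Lemma enorm_ge0 x : 0 <= enorm x. Proof. exact: sqrtr_ge0. Qed.

Lemma enorm_sqr x : enorm x ^+ 2 = \sum_(i < N) x ord0 i ^+ 2.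
Proof. by rewrite sqr_sqrtr// sumr_ge0// => i _; exact: sqr_ge0. Qed.

Lemma enorm0 : enorm (0 : 'rV[R]_N) = 0.
Proof.
by rewrite /enorm big1 ?sqrtr0// => i _; rewrite mxE expr0n.
Qed.

Lemma coord_le_enorm x i : `|x ord0 i| <= enorm x.
Proof.
rewrite -sqrtr_sqr ler_wsqrtr// (bigD1 i)//= lerDl sumr_ge0// => j _.
exact: sqr_ge0.
Qed.

Lemma enorm_continuous : continuous (@enorm R N).
Proof.
have sumc (s : seq 'I_N) :
    continuous (fun x : 'rV[R]_N => \sum_(i <- s) x ord0 i ^+ 2).
  elim: s => [|i s IH] x.
    rewrite (_ : (fun _ => _) = cst (0 : R)); first exact: cst_continuous.
    by apply/funext => y; rewrite big_nil.
  rewrite (_ : (fun _ => _) = (fun y : 'rV[R]_N => y ord0 i ^+ 2 +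
    \sum_(j <- s) y ord0 j ^+ 2)); last by apply/funext => y; rewrite big_cons.
  have c1 := @coord_continuous R 1 N ord0 i x.
  exact: (cvgD (cvgM c1 c1) (IH x)).
by move=> x; apply: continuous_comp; [exact: sumc|exact: sqrt_continuous].
Qed.

Lemma measurable_enorm_lt (d : R) :
  measurable [set x : 'rV[R]_N | enorm x < d].
Proof.
apply: open_measurable_rV.
rewrite (_ : mkset _ = @enorm R N @^-1` [set r | r < d])//.
apply: open_comp; last exact: open_lt.
by move=> x _; exact: enorm_continuous.
Qed.

Lemma measurable_unit_ball : measurable (unit_ball R N).
Proof. exact: measurable_enorm_lt. Qed.

Lemma unit_ball_closed x : unit_ball R N x -> closed_unit_ball R N x.
Proof. exact: ltW. Qed.

Lemma closed_closed_unit_ball : closed (closed_unit_ball R N).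
Proof.
rewrite (_ : closed_unit_ball R N = ~` (@enorm R N @^-1` [set r | 1 < r])).
  apply: open_closedC; apply: open_comp; last exact: open_gt.
  by move=> x _; exact: enorm_continuous.
by apply/seteqP; split => x /=; rewrite /closed_unit_ball /= leNgt => /negP.
Qed.

Lemma measurable_closed_unit_ball : measurable (closed_unit_ball R N).
Proof. exact: closed_measurable_rV closed_closed_unit_ball. Qed.

Lemma bounded_box_finite (A : set 'rV[R]_N) (c : R) : measurable A ->
  (forall x i, A x -> `|x ord0 i| <= c) -> (lebesgue_rV R N A < +oo)%E.
Proof.
move=> mA Ac; pose Q := fun _ : 'I_N => `[- c, c]%classic : set (measurableTypeR R).
have mQ i : measurable (Q i) by exact: measurable_itv.
apply: (@le_lt_trans _ _ (lebesgue_rV R N [set x | forall i, Q i (coord_rV i x)])).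
  apply: le_measure; [by rewrite inE | by rewrite inE; exact: measurable_box |].
  by move=> x Ax i; rewrite /Q /= in_itv/= -ler_norml; exact: Ac.
rewrite lebesgue_rV_prod// ltey_eq; apply/orP; left.
apply: (big_ind (fun x : \bar R => is_true (x \is a fin_num))) => //.
- by move=> a b; exact: fin_numM.
- by move=> i _; rewrite /Q lebesgue_measure_itv/=; case: ifP.
Qed.

Lemma unit_ball_finite : (lebesgue_rV R N (unit_ball R N) < +oo)%E.
Proof.
apply: (@bounded_box_finite _ 1); first exact: measurable_unit_ball.
by move=> x i /ltW; apply: le_trans; exact: coord_le_enorm.
Qed.

(** A ball contains a cube with a vertex at its centre. *)
Lemma small_ball_pos (d : R) : 0 < d ->
  (0 < lebesgue_rV R N [set x : 'rV[R]_N | (enorm x < d)%R])%E.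
Proof.
move=> d0; pose c := d / N.+1%:R.
have c0 : 0 < c by rewrite divr_gt0.
pose Q := fun _ : 'I_N => `]0, c[%classic : set (measurableTypeR R).
have mQ i : measurable (Q i) by exact: measurable_itv.
have md := measurable_enorm_lt d.
apply: (@lt_le_trans _ _
    (lebesgue_rV R N [set x | forall i, Q i (coord_rV i x)])).
  rewrite lebesgue_rV_prod//; apply: (big_ind (fun x : \bar R => is_true (0 < x)%E)) => //.
  - by move=> a b a0 b0; rewrite mule_gt0.
  - by move=> i _; rewrite /Q lebesgue_measure_itv/= lte_fin c0 sube0 lte_fin.
apply: le_measure; [by rewrite inE; exact: measurable_box | by rewrite inE |].
move=> x xQ /=; rewrite -(ltr_pXn2r (n := 2)) ?nnegrE ?enorm_ge0 ?ltW//.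
rewrite enorm_sqr.
apply: (@le_lt_trans _ _ (\sum_(i < N) c ^+ 2)).
  apply: ler_sum => i _; rewrite lerXn2r ?nnegrE//; last 2 first.
  - by rewrite ltW.
  - by have := xQ i; rewrite /Q /= in_itv/= => /andP[_ /ltW].
  by have := xQ i; rewrite /Q /= in_itv/= => /andP[/ltW].
rewrite sumr_const card_ord -mulr_natl /c exprMn mulrCA -[ltRHS]mulr1.
rewrite ltr_pM2l ?exprn_gt0// exprVn ltr_pdivrMr ?exprn_gt0// mul1r.
rewrite -natrX ltr_nat expnS expn1.
by rewrite mulSn ltn_addr// ltnS.
Qed.

End enorm.

(** * Slicing Lebesgue measure in one coordinate *)

Section insertion.
Context {R : realType} {n : nat}.
Variable i : 'I_n.+1.

Definition insert_rV (p : measurableTypeR R * 'rV[R]_n) : 'rV[R]_n.+1 :=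
  \row_k (if unlift i k is Some j then p.2 ord0 j else p.1).

Lemma insert_rV_same p : insert_rV p ord0 i = p.1.
Proof. by rewrite mxE unlift_none. Qed.

Lemma insert_rV_lift p j : insert_rV p ord0 (lift i j) = p.2 ord0 j.
Proof. by rewrite mxE liftK. Qed.

Lemma measurable_insert_rV :
  measurable_fun [set: measurableTypeR R * 'rV[R]_n] insert_rV.
Proof.
apply: measurable_fun_rV => k; rewrite /comp /coord_rV /insert_rV.
under eq_fun do rewrite mxE.
case: unliftP => [j _|_]; last exact: measurable_fst.
exact: (measurableT_comp (measurable_coord_rV j)).
Qed.

Lemma insert_box (A : 'I_n.+1 -> set (measurableTypeR R)) :
  insert_rV @^-1` [set x | forall k, A k (coord_rV k x)] =
  A i `*` [set y : 'rV[R]_n | forall j, A (lift i j) (coord_rV j y)].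
Proof.
apply/seteqP; split=> -[t x] /=.
  move=> h; split; first by have := h i; rewrite /coord_rV insert_rV_same.
  by move=> j; have := h (lift i j); rewrite /coord_rV insert_rV_lift.
move=> [tA xB] k; rewrite /coord_rV.
by case: (unliftP i k) => [j ->|->]; rewrite ?insert_rV_lift ?insert_rV_same.
Qed.

Let pm : {measure set 'rV[R]_n.+1 -> \bar R} :=
  measure_function_pushforward__canonical__measure_function_Measure
    (@lebesgue_measure R \x lebesgue_rV R n)%E measurable_insert_rV.

(** The measure is built by adding coordinates at the front, but any coordinate may
serve: both sides agree on boxes, which generate the Borel sets. *)
Lemma lebesgue_rV_insert (A : set 'rV[R]_n.+1) : measurable A ->
  lebesgue_rV R n.+1 A =
  (@lebesgue_measure R \x lebesgue_rV R n)%E (insert_rV @^-1` A).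
Proof.
move=> mA.
pose G := [set X : set 'rV[R]_n.+1 | exists2 A : 'I_n.+1 -> set (measurableTypeR R),
  (forall k, measurable (A k)) & X = [set x | forall k, A k (coord_rV k x)]].
pose g (m : nat) : set 'rV[R]_n.+1 :=
  [set x | forall k, (`[- m%:R, m%:R]%classic : set (measurableTypeR R)) (coord_rV k x)].
apply: (@measure_unique _ R _ G g _ _ _ _ (lebesgue_rV R n.+1) pm _ _ A mA).
- apply/seteqP; split.
    apply: smallest_sub; first exact: smallest_sigma_algebra.
    move=> X; rewrite -bigcup_seq => -[k _ [B mB <-]]; rewrite setTI.
    apply: sub_sigma_algebra; exists (fun j => if j == k then B else setT).
      by move=> j; case: ifP.
    apply/seteqP; split=> x /=.
      by move=> Bx j; case: eqP => // ->.
    by move=> /(_ k); rewrite eqxx.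
  apply: smallest_sub; first exact: sigma_algebra_measurable.
  by move=> X [B mB ->]; exact: measurable_box.
- move=> X Y [B mB ->] [C mC ->]; exists (fun k => B k `&` C k).
    by move=> k; exact: measurableI.
  by apply/seteqP; split=> x /=; [move=> [h1 h2] k|move=> h; split=> k; have [] := h k].
- by move=> m; exists (fun=> `[- m%:R, m%:R]%classic).
- apply/seteqP; split=> // x _; exists (Num.truncn (enorm x)).+1 => // k.
  rewrite /= in_itv/= -ler_norml; apply: (le_trans (coord_le_enorm x k)).
  by apply: ltW; exact: truncnS_gt.
- move=> X [B mB ->]; apply: (etrans (lebesgue_rV_prod mB)).
  rewrite (bigD1_ord i)//= /pm /= /pushforward insert_box product_measure1E//.
    congr (_ * _)%E.
    by apply/esym/(lebesgue_rV_prod (A := fun j => B (lift i j))) => j.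
  by apply: (measurable_box (A := fun j => B (lift i j))) => j.
- move=> m; apply: (@bounded_box_finite _ _ _ m%:R).
    apply: (measurable_box (A := fun=> `[- m%:R, m%:R]%classic)) => k.
    exact: measurable_itv.
  by move=> x k /(_ k); rewrite /= in_itv/= -ler_norml.
Qed.

(** Fubini, with the coordinate i integrated first. *)
Lemma slice_integral_zero (B : set 'rV[R]_n.+1) (f : 'rV[R]_n.+1 -> R) (K : R) :
  measurable B -> (lebesgue_rV R n.+1 B < +oo)%E -> measurable_fun B f ->
  (forall x, B x -> `|f x| <= K) ->
  (forall y, \int[@lebesgue_measure R]_(t in [set t | B (insert_rV (t, y))])
     (f (insert_rV (t, y)))%:E = 0)%E ->
  (\int[lebesgue_rV R n.+1]_(x in B) (f x)%:E = 0)%E.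
Proof.
move=> mB Boo mf fK f0.
pose f1 := EFin \o (f \_ B).
have mIB : measurable (insert_rV @^-1` B).
  by rewrite -[X in measurable X]setTI; exact: measurable_insert_rV.
have mfi : measurable_fun (insert_rV @^-1` B) (f \o insert_rV).
  apply: (measurable_comp (F := B)) => //; first by move=> x [p Bp <-].
  exact: measurable_funTS measurable_insert_rV.
have If : (@lebesgue_measure R \x lebesgue_rV R n)%E.-integrable setT
    (f1 \o insert_rV).
  have H : (@lebesgue_measure R \x lebesgue_rV R n)%E.-integrable
      (insert_rV @^-1` B) (EFin \o (f \o insert_rV)).
    apply: (@bounded_integrable _ _ _ _ _ mIB _ _ K) => //.
      apply: le_lt_trans Boo; rewrite le_eqVlt; apply/orP; left.
      exact/eqP/esym/lebesgue_rV_insert.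
    by apply: aeW => p Bp; exact: fK.
  move: H; rewrite (integrable_mkcond _ mIB); congr (_.-integrable _ _).
  apply/funext => p; rewrite /f1 /patch /=.
  have -> : (p \in insert_rV @^-1` B) = (insert_rV p \in B).
    by apply/idP/idP; rewrite !inE.
  by case: ifPn.
have -> : (\int[lebesgue_rV R n.+1]_(x in B) (f x)%:E = \int[pm]_x f1 x)%E.
  rewrite integral_mkcond (eq_measure_integral pm).
    by apply: eq_integral => x _; rewrite /f1 /patch /=; case: ifPn.
  by move=> X mX _; exact: lebesgue_rV_insert.
have mf1 : measurable_fun setT f1.
  by apply/measurable_EFinP; apply/measurable_restrict => //; rewrite setTI.
transitivity (\int[(@lebesgue_measure R \x lebesgue_rV R n)%E]_p
    (f1 \o insert_rV) p)%E.
  exact: (integral_pushforward measurable_insert_rV mf1 If measurableT).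
rewrite -(integral21_prod_meas1 If).
rewrite -[RHS](@integral0 _ _ _ (lebesgue_rV R n) setT).
apply: eq_integral => y _; rewrite -[RHS](f0 y) /fubini_G /= [RHS]integral_mkcond.
apply: eq_integral => t _; rewrite /f1 /patch /=.
have -> : (t \in [set t | B (insert_rV (t, y))]) = (insert_rV (t, y) \in B).
  by apply/idP/idP; rewrite !inE.
by case: ifPn.
Qed.

End insertion.

(** * Functions on the closed ball and their restrictions to chords *)

Section closed_ball_functions.
Context {R : realType} {N : nat}.
Implicit Types f g : 'rV[R]_N -> R.
Local Notation CB := (closed_unit_ball R N).

Lemma compact_closed_unit_ball : compact CB.
Proof.
apply: bounded_closed_compact; last exact: closed_closed_unit_ball.
exists 1; split => // r r1 x /= x1.
rewrite [leLHS]/Num.norm /= mx_normrE; apply/bigmax_leP; split => [|i _]; first by lra.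
case: i => i j /=; rewrite ord1; apply: (le_trans (coord_le_enorm x j)).
exact: le_trans x1 (ltW r1).
Qed.

Lemma closed_ball_bounded f : {within CB, continuous f} ->
  exists2 K, 0 <= K & forall x, CB x -> `|f x| <= K.
Proof.
move=> cf; have CB0 : CB !=set0.
  by exists 0; rewrite /closed_unit_ball /= enorm0.
have [c _ fc] := EVT_max_rV CB0 compact_closed_unit_ball cf.
have [e _ fe] := EVT_min_rV CB0 compact_closed_unit_ball cf.
exists (`|f c| + `|f e|); first by rewrite addr_ge0.
move=> x /mem_set Bx; have := fc x Bx; have := fe x Bx.
have := ler_norm (f c); have := ler_norm (- f e); rewrite normrN.
have := normr_ge0 (f c); have := normr_ge0 (f e).
by rewrite ler_norml; lra.
Qed.

Lemma extension_bounded f : extends_to_closed_ball f ->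
  exists2 K, 0 <= K & forall x, unit_ball R N x -> `|f x| <= K.
Proof.
move=> [g /closed_ball_bounded[K K0 gK] fg]; exists K => // x Bx.
by rewrite fg//; apply: gK; exact: unit_ball_closed.
Qed.

Lemma extension_measurable f : extends_to_closed_ball f ->
  measurable_fun (unit_ball R N) f.
Proof.
move=> [g cg fg]; apply: (eq_measurable_fun g).
  by move=> x; rewrite inE => /fg.
apply: (@measurable_funS _ _ _ _ CB); first exact: measurable_closed_unit_ball.
  by move=> x; exact: unit_ball_closed.
apply: within_continuous_measurable_rV => //.
exact: measurable_closed_unit_ball.
Qed.

Lemma extensionM f g : extends_to_closed_ball f -> extends_to_closed_ball g ->
  extends_to_closed_ball (fun x => f x * g x).
Proof.
move=> [f' cf ff] [g' cg gg]; exists (fun x => f' x * g' x).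
  by move=> x; apply: cvgM; [exact: cf|exact: cg].
by move=> x Bx; rewrite ff// gg.
Qed.

Lemma extensionD f g : extends_to_closed_ball f -> extends_to_closed_ball g ->
  extends_to_closed_ball (fun x => f x + g x).
Proof.
move=> [f' cf ff] [g' cg gg]; exists (fun x => f' x + g' x).
  by move=> x; apply: cvgD; [exact: cf|exact: cg].
by move=> x Bx; rewrite ff// gg.
Qed.

Lemma extensionN f : extends_to_closed_ball f ->
  extends_to_closed_ball (fun x => - f x).
Proof.
move=> [f' cf ff]; exists (fun x => - f' x).
  by move=> x; apply: cvgN; exact: cf.
by move=> x Bx; rewrite ff.
Qed.

Lemma extension_cst (c : R) : extends_to_closed_ball (fun _ : 'rV[R]_N => c).
Proof. by exists (fun=> c) => // x; exact: cvg_cst. Qed.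

Lemma extension_within f : {within CB, continuous f} -> extends_to_closed_ball f.
Proof. by exists f. Qed.

Lemma extension_sum (I : Type) (s : seq I) (F : I -> 'rV[R]_N -> R) :
  (forall i, extends_to_closed_ball (F i)) ->
  extends_to_closed_ball (fun x => \sum_(i <- s) F i x).
Proof.
move=> FE; elim: s => [|i s IH].
  rewrite (_ : (fun _ => _) = (fun=> 0)); first exact: extension_cst.
  by apply/funext => x; rewrite big_nil.
rewrite (_ : (fun _ => _) = (fun x => F i x + \sum_(j <- s) F j x)).
  exact: extensionD.
by apply/funext => x; rewrite big_cons.
Qed.

Lemma extension_integrable f : extends_to_closed_ball f ->
  (lebesgue_rV R N).-integrable (unit_ball R N) (EFin \o f).
Proof.
move=> fE; have [K _ fK] := extension_bounded fE.
apply: (bounded_integrable measurable_unit_ball unit_ball_finite (K := K)).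
  exact: extension_measurable.
exact: aeW.
Qed.

Lemma extension_laplacian f : test_function f ->
  extends_to_closed_ball (laplacian f).
Proof. by move=> [_ _ _ _ [_ h]]; apply: extension_sum => i; exact: h. Qed.

End closed_ball_functions.

Section chords.
Context {R : realType} {n : nat}.
Variable i : 'I_n.+1.
Variable y : 'rV[R]_n.
Let e := @basis_rV R n.+1 i.
Let line (t : R) : 'rV[R]_n.+1 := insert_rV i (t, y).

Lemma line_shift (t h : R) : line (h + t) = h *: e + line t.
Proof.
apply/rowP => k; rewrite /line !mxE eqxx /=.
case: (unliftP i k) => [j ->|->] /=.
  by rewrite eq_sym (negbTE (neq_lift i j)) mulr0 add0r.
by rewrite eqxx mulr1.
Qed.

Lemma line_continuous : continuous line.
Proof.
move=> t; rewrite (_ : line = (fun s => (s - t) *: e + line t)); last first.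
  by apply/funext => s; rewrite -line_shift subrK.
rewrite /continuous_at; apply: cvgD; last exact: cvg_cst.
apply: cvgZr_tmp.
apply: cvgB; [exact: cvg_id|exact: cvg_cst].
Qed.

Lemma line_derive (f : 'rV[R]_n.+1 -> R) (t : R) : derivable f (line t) e ->
  is_derive t 1 (f \o line) ('D_e f (line t)).
Proof.
move=> df.
have E : (fun h : R => h^-1 *: ((f \o shift (line t)) (h *: e) - f (line t))) =
    (fun h : R => h^-1 *: (((f \o line) \o shift t) (h *: (1:R)) - (f \o line) t)).
  by apply/funext => h /=; rewrite /shift /= [h *: 1]mulr1 line_shift.
by apply: DeriveDef; rewrite /derivable /derive -E.
Qed.

Lemma enorm_line (t : R) : enorm (line t) ^+ 2 = t ^+ 2 + enorm y ^+ 2.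
Proof.
rewrite !enorm_sqr (bigD1_ord i)//= insert_rV_same; congr (_ + _).
by apply: eq_bigr => j _; rewrite insert_rV_lift.
Qed.

Lemma unit_ball_line (t : R) :
  unit_ball R n.+1 (line t) <-> t ^+ 2 + enorm y ^+ 2 < 1.
Proof.
by rewrite -enorm_line /unit_ball /= expr_lt1// enorm_ge0.
Qed.

Lemma within_line (a b : R) (f : 'rV[R]_n.+1 -> R) :
  (forall t, a <= t <= b -> closed_unit_ball R n.+1 (line t)) ->
  {within closed_unit_ball R n.+1, continuous f} ->
  {within `[a, b], continuous (f \o line)}.
Proof.
move=> ab /subspace_continuousP cf; apply/subspace_continuousP => t /=.
rewrite in_itv/= => tab; have Bt := ab _ tab.
move=> U fU; have H := cf _ Bt U fU.
have H2 : \forall s \near nbhs t, closed_unit_ball R n.+1 (line s) -> U (f (line s)).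
  exact: (@line_continuous t _ H).
suff H3 : \forall s \near nbhs t, `[a, b]%classic s -> U (f (line s)) by exact: H3.
apply: filterS H2 => s h; rewrite /= in_itv/= => sab.
by apply: h; exact: ab.
Qed.

End chords.

(** * Green's identity *)

Section green.
Context {R : realType} {n : nat}.
Implicit Types phi chi : 'rV[R]_n.+1 -> R.
Local Notation B := (unit_ball R n.+1).
Local Notation CB := (closed_unit_ball R n.+1).
Local Notation mu := (lebesgue_rV R n.+1).
Local Notation e i := (@basis_rV R n.+1 i).

(** The integrand is the derivative along the chord of phi D_i chi - chi D_i phi,
which extends continuously to the end points of the chord and vanishes there,
because phi and chi vanish on the sphere. *)
Lemma green_chord i (y : 'rV[R]_n) phi chi :
  test_function phi -> test_function chi ->
  (\int[@lebesgue_measure R]_(t in [set t | B (insert_rV i (t, y))])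
    ((fun x => phi x * 'D_(e i) ('D_(e i) chi) x -
     chi x * 'D_(e i) ('D_(e i) phi) x) (insert_rV i (t, y)))%:E = 0)%E.
Proof.
move=> [cphi phi0 dphi ddphi [ephi eephi]] [cchi chi0 dchi ddchi [echi eechi]].
pose line (t : R) := insert_rV i (t, y).
have [y1|y1] := leP 1 (enorm y ^+ 2).
  rewrite (_ : mkset _ = set0) ?integral_set0//.
  apply/seteqP; split => // t /= /unit_ball_line.
  by have := sqr_ge0 t; lra.
pose a := Num.sqrt (1 - enorm y ^+ 2).
have a0 : 0 < a by rewrite sqrtr_gt0; lra.
have a2 : a ^+ 2 = 1 - enorm y ^+ 2 by rewrite sqr_sqrtr//; lra.
have BE t : B (line t) <-> - a < t < a.
  rewrite /line; split => [/unit_ball_line h|h].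
    by rewrite -ltr_norml -sqrtr_sqr ltr_sqrt; lra.
  apply/unit_ball_line; move: h; rewrite -ltr_norml => h.
  have : `|t| ^+ 2 < a ^+ 2 by rewrite ltrXn2r// nnegrE ltW.
  by rewrite a2 real_normK ?num_real//; lra.
rewrite (_ : mkset _ = `]- a, a[%classic); last first.
  by apply/seteqP; split => t /=; rewrite in_itv/= => /BE.
have CBE t : - a <= t <= a -> CB (line t).
  move=> ta; rewrite /closed_unit_ball /= -(@expr_le1 _ 2) ?enorm_ge0//.
  rewrite /line enorm_line.
  have : `|t| ^+ 2 <= a ^+ 2 by rewrite lerXn2r ?nnegrE ?(ltW a0)// ler_norml.
  by rewrite a2 real_normK ?num_real//; lra.
have S1 t : t ^+ 2 = a ^+ 2 -> enorm (line t) = 1.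
  move=> ta; apply/eqP; rewrite -(@eqrXn2 _ 2) ?enorm_ge0// /line enorm_line ta a2.
  by rewrite expr1n subrK.
have [gp cgp Egp] := ephi i.
have [gc cgc Egc] := echi i.
have [hp chp Ehp] := eephi i i.
have [hc chc Ehc] := eechi i i.
pose f t := phi (line t) * hc (line t) - chi (line t) * hp (line t).
pose G t := phi (line t) * gc (line t) - chi (line t) * gp (line t).
have wl (g : 'rV[R]_n.+1 -> R) : {within CB, continuous g} -> {within `[- a, a], continuous (g \o line)}.
  exact: (@within_line R n i y (- a) a g CBE).
have wM (g h : 'rV[R]_n.+1 -> R) : {within CB, continuous g} -> {within CB, continuous h} ->
    {within `[- a, a], continuous (fun t => g (line t) * h (line t))}.
  by move=> cg ch t; apply: cvgM; [exact: (wl _ cg)|exact: (wl _ ch)].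
have cf : {within `[- a, a], continuous f}.
  by move=> t; apply: cvgB; exact: wM.
have cG : {within `[- a, a], continuous G}.
  by move=> t; apply: cvgB; exact: wM.
have aa : - a < a by lra.
have dG t : - a < t < a -> is_derive t 1 G (f t).
  move=> /[dup] ta /BE Bt.
  have L1 := line_derive (dphi i _ Bt).
  have L2 := line_derive (dchi i _ Bt).
  have L3 := line_derive (ddphi i i _ Bt).
  have L4 := line_derive (ddchi i i _ Bt).
  have LD := is_deriveB_fun (is_deriveM_fun L1 L4) (is_deriveM_fun L2 L3).
  apply: is_derive_eq (near_eq_is_derive _ LD) _.
    have /andP[ta1 ta2] := ta.
    near=> s; have Bs : B (line s).
      by apply/BE/andP; split; near: s; [exact: lt_nbhsr|exact: lt_nbhsl].
    by rewrite /G /= -/(line s) Egc// Egp.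
  rewrite /f /= -/(line t) Ehc// Ehp//; ring.
have mf : measurable_fun `]- a, a[ f.
  apply: (@measurable_funS _ _ _ _ `[- a, a]) => //; first exact: subset_itv_oo_cc.
  exact: subspace_continuous_measurable_fun.
transitivity (\int[@lebesgue_measure R]_(t in `](- a)%R, a[) (f t)%:E)%E.
  apply: eq_integral => t; rewrite inE/= in_itv/= => /BE Bt.
  by rewrite /f /= Ehp// Ehc.
rewrite -(@integral_itv_bndoo R (- a) a (EFin \o f) true false); last first.
  exact/measurable_EFinP.
have /(continuous_within_itvP _ aa)[_ cl cr] := cG.
rewrite (@continuous_FTC2 _ f G (- a) a)//; last 2 first.
- by split=> // t; rewrite in_itv/= => /dG[].
- by move=> t; rewrite in_itv/= => /dG[_]; rewrite derive1E.
by rewrite /G !phi0 ?chi0 ?S1 ?sqrrN// !mul0r subrr -EFinB subrr.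
Unshelve. all: by end_near. Qed.

Lemma test_extension phi : test_function phi -> extends_to_closed_ball phi.
Proof. by move=> [cphi _ _ _ _]; exact: extension_within. Qed.

Lemma green_coord i phi chi : test_function phi -> test_function chi ->
  (\int[mu]_(x in B) (phi x * 'D_(e i) ('D_(e i) chi) x -
     chi x * 'D_(e i) ('D_(e i) phi) x)%:E = 0)%E.
Proof.
move=> tp tc; have E : extends_to_closed_ball (fun x =>
    phi x * 'D_(e i) ('D_(e i) chi) x - chi x * 'D_(e i) ('D_(e i) phi) x).
  apply: extensionD; [|apply: extensionN]; apply: extensionM.
  - exact: test_extension.
  - by case: tc => _ _ _ _ [_].
  - exact: test_extension.
  - by case: tp => _ _ _ _ [_].
have [K _ EK] := extension_bounded E.
apply: (slice_integral_zero (i := i) measurable_unit_ball unit_ball_finite _ EK).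
  exact: extension_measurable.
by move=> y; exact: green_chord.
Qed.

Lemma green_identity phi chi : test_function phi -> test_function chi ->
  \int[mu]_(x in B) (phi x * - laplacian chi x) =
  \int[mu]_(x in B) (chi x * - laplacian phi x).
Proof.
move=> tp tc; apply/eqP; rewrite -subr_eq0 -RintegralB; last 3 first.
- exact: measurable_unit_ball.
- apply: extension_integrable; apply: extensionM; first exact: test_extension.
  by apply: extensionN; exact: extension_laplacian.
- apply: extension_integrable; apply: extensionM; first exact: test_extension.
  by apply: extensionN; exact: extension_laplacian.
pose h i x := chi x * 'D_(e i) ('D_(e i) phi) x - phi x * 'D_(e i) ('D_(e i) chi) x.
have hE i : extends_to_closed_ball (h i).
  apply: extensionD; [|apply: extensionN]; apply: extensionM.
  - exact: test_extension.
  - by case: tp => _ _ _ _ [_].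
  - exact: test_extension.
  - by case: tc => _ _ _ _ [_].
have -> : (fun x => phi x * - laplacian chi x - chi x * - laplacian phi x) =
    (fun x => \sum_i h i x).
  apply/funext => x; rewrite /h sumrB -2!mulr_sumr.
  rewrite -/(laplacian phi x) -/(laplacian chi x).
  by rewrite !mulrN opprK addrC.
have H (s : seq 'I_n.+1) : \int[mu]_(x in B) (\sum_(i <- s) h i x) = 0.
  elim: s => [|i s IH].
    under eq_Rintegral do rewrite big_nil.
    by rewrite Rintegral_cst ?mul0r//; exact: measurable_unit_ball.
  under eq_Rintegral do rewrite big_cons.
  rewrite RintegralD//; last 3 first.
  - exact: measurable_unit_ball.
  - exact: extension_integrable.
  - by apply: extension_integrable; exact: extension_sum.
  by rewrite IH addr0 /Rintegral /h green_coord.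
by rewrite H.
Qed.

End green.

(** * Radial potentials as test functions *)

Section radial_test_function.
Context {R : realType} {n : nat}.
Variable g : R -> R.
Hypothesis cg : continuous g.
Implicit Types x : 'rV[R]_n.+1.
Local Notation e i := (@basis_rV R n.+1 i).
Local Notation r x := (@enorm R n.+1 x).
Local Notation P := (slope n g).

Definition radial_potential x : R := potential n g (enorm x ^+ 2).

Let tail (i : 'I_n.+1) x : 'rV[R]_n := \row_j x ord0 (lift i j).

Let insert_tail i x : insert_rV i (x ord0 i, tail i x) = x.
Proof.
apply/rowP => k; rewrite mxE.
by case: (unliftP i k) => [j ->|->] //=; rewrite mxE.
Qed.

(** Converse of [line_derive]: a directional derivative along an axis may be computed
on the line through x. *)
Lemma line_is_derive i (f : 'rV[R]_n.+1 -> R) x (d : R) :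
  is_derive (x ord0 i) 1 (fun t : R => f (insert_rV i (t, tail i x))) d ->
  is_derive x (e i) f d.
Proof.
have E : (fun h : R => h^-1 *: ((f \o shift x) (h *: e i) - f x)) =
    (fun h : R => h^-1 *: (((fun t => f (insert_rV i (t, tail i x))) \o
       shift (x ord0 i)) (h *: (1:R)) - f (insert_rV i (x ord0 i, tail i x)))).
  apply/funext => h /=; rewrite /shift /= [h *: 1]mulr1.
  by rewrite line_shift insert_tail.
by move=> [dd <-]; apply: DeriveDef; rewrite /derivable /derive E.
Qed.

Let sqr_line i x (t : R) :
  enorm (insert_rV i (t, tail i x)) ^+ 2 = t ^+ 2 + enorm (tail i x) ^+ 2.
Proof. exact: enorm_line. Qed.

Let sqr_line_derive i x : is_derive (x ord0 i) 1
  (fun t : R => enorm (insert_rV i (t, tail i x)) ^+ 2) (2 * x ord0 i).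
Proof.
rewrite (_ : (fun _ => _) = (fun t : R => t ^+ 2 + enorm (tail i x) ^+ 2)).
  apply: is_derive_eq (is_deriveD_fun
    (is_derive_sqr_fun (is_derive_id_fun (x ord0 i)))
    (is_derive_cst_fun (enorm (tail i x) ^+ 2) (x ord0 i))) _.
  by ring.
by apply/funext => t; rewrite sqr_line.
Qed.

Lemma radial_potential_derive i x :
  is_derive x (e i) radial_potential (- P (r x) * x ord0 i).
Proof.
apply: line_is_derive; rewrite /radial_potential.
have h : -1 < enorm (insert_rV i (x ord0 i, tail i x)) ^+ 2.
  by have := sqr_ge0 (enorm (insert_rV i (x ord0 i, tail i x))); lra.
have := @is_derive1_comp R (potential n g)
  (fun t : R => enorm (insert_rV i (t, tail i x)) ^+ 2) (x ord0 i) _ _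
  (potential_derive n cg h) (sqr_line_derive i x).
rewrite insert_tail sqrtr_sqr ger0_norm ?enorm_ge0// => H.
by apply: is_derive_eq H _; field.
Qed.

Lemma radial_potential_deriveE i :
  'D_(e i) radial_potential = (fun x => - P (r x) * x ord0 i).
Proof.
by apply/funext => x; have [_ ->] := radial_potential_derive i x.
Qed.

Lemma is_derive_mulid_at0 (c : R -> R) : {for 0, continuous c} ->
  is_derive (0 : R) 1 (fun t => c t * t) (c 0).
Proof.
move=> cc.
have H : (fun h : R => h^-1 *: (((fun t => c t * t) \o shift 0) (h *: (1:R)) -
    (fun t => c t * t) 0)) @ (0 : R)^' --> c 0.
  apply: (@cvg_trans _ (c @ (0 : R)^')); last first.
    by apply: cvg_trans cc; apply: cvg_app; exact: cvg_within.
  apply: near_eq_cvg; near=> h.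
  have h0 : h != 0 by near: h; exact: nbhs_dnbhs_neq.
  rewrite /= /shift /= addr0 [h *: 1]mulr1 mulr0 subr0 /GRing.scale /=.
  by rewrite mulrC mulfK.
apply: DeriveDef; first by apply/cvg_ex; exists (c 0).
exact: cvg_lim H.
Unshelve. all: by end_near. Qed.

Let Q x := (g (r x) - n.+1%:R * P (r x)) / r x ^+ 2.

Let coord_line i j x (t : R) : insert_rV i (t, tail i x) ord0 j =
  if i == j then t else x ord0 j.
Proof.
rewrite mxE; case: (unliftP i j) => [k ->|->]; last by rewrite eqxx.
by rewrite (negbTE (neq_lift i k)) mxE.
Qed.

Lemma enorm_eq0 x : (enorm x == 0) = (x == 0).
Proof.
apply/eqP/eqP => [x0|->]; last exact: enorm0.
apply/rowP => i; rewrite mxE; apply/eqP; rewrite -normr_le0 -x0.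
exact: coord_le_enorm.
Qed.

(** Off the origin this is the chain rule; at the origin [slope] is only known to be
continuous, and the derivative comes from the factor x_i. There the quotient in
[Q] is 0, as division by zero is, which is the correct value. *)
Lemma radial_potential_derive2 i j x :
  is_derive x (e j) ('D_(e i) radial_potential)
    (- P (r x) * (i == j)%:R - Q x * x ord0 i * x ord0 j).
Proof.
rewrite radial_potential_deriveE.
apply: line_is_derive => /=.
have [x0|x0] := eqVneq x 0.
  rewrite x0 {x x0}; have t0 : tail j 0 = 0 by apply/rowP => k; rewrite !mxE.
  rewrite /Q enorm0 !mxE !mulr0 subr0.
  have [ij|ij] := eqVneq i j; last first.
    rewrite mulr0 (_ : (fun _ => _) = (fun=> 0 : R)).
      exact: is_derive_cst_fun.
    apply/funext => t; rewrite coord_line eq_sym (negbTE ij).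
    by rewrite mxE mulr0.
  rewrite mulr1 (_ : (fun _ => _) = (fun t => - P `|t| * t)).
    have -> : - P 0 = - P `|0 : R| by rewrite normr0.
    apply: (is_derive_mulid_at0 (c := fun t => - P `|t|)).
    apply: cvgN; apply: (@continuous_comp _ _ _ (fun t : R => `|t|) P).
      exact: norm_continuous.
    exact: slope_continuous.
  apply/funext => t; rewrite coord_line ij eqxx; congr (- P _ * _).
  rewrite -[LHS]ger0_norm ?enorm_ge0// -sqrtr_sqr sqr_line t0.
  by rewrite enorm0 expr0n addr0 sqrtr_sqr.
have r0 : 0 < r x by rewrite lt_def enorm_eq0 x0 enorm_ge0.
have d1 : is_derive (x ord0 j) 1 (fun t : R => r (insert_rV j (t, tail j x)))
    (x ord0 j / r x).
  rewrite (_ : (fun _ => _) = Num.sqrt \o (fun t : R => enorm (insert_rV j (t, tail j x)) ^+ 2)).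
    have s0 : 0 < enorm (insert_rV j (x ord0 j, tail j x)) ^+ 2.
      by rewrite insert_tail exprn_gt0.
    have := @is_derive1_comp R Num.sqrt _ (x ord0 j) _ _ (is_derive1_sqrt s0)
      (sqr_line_derive j x).
    rewrite insert_tail sqrtr_sqr ger0_norm ?enorm_ge0// => H.
    apply: is_derive_eq H _; field.
    by rewrite gt_eqF.
  by apply/funext => t /=; rewrite sqrtr_sqr ger0_norm// enorm_ge0.
have dP : is_derive (r (insert_rV j (x ord0 j, tail j x))) 1 P
    ((g (r x) - n.+1%:R * P (r x)) / r x).
  by rewrite insert_tail; exact: slope_derive.
have d2 := @is_derive1_comp R P (fun t : R => r (insert_rV j (t, tail j x)))
  (x ord0 j) _ _ dP d1.
have d3 : is_derive (x ord0 j) 1 (fun t : R => insert_rV j (t, tail j x) ord0 i)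
    (i == j)%:R.
  rewrite (_ : (fun _ => _) = (fun t => if j == i then t else x ord0 i)).
    rewrite (eq_sym i j); case: (j == i) => /=; first exact: is_derive_id_fun.
    exact: is_derive_cst_fun.
  by apply/funext => t; rewrite coord_line.
rewrite (_ : (fun _ => _) = (fun t : R => - 1 * (P (r (insert_rV j (t, tail j x))) *
   insert_rV j (t, tail j x) ord0 i))); last first.
  by apply/funext => t; rewrite mulN1r mulNr.
apply: is_derive_eq (is_deriveZ_fun (- 1) (is_deriveM_fun d2 d3)) _.
by rewrite /= insert_tail /Q; field; rewrite gt_eqF.
Qed.

Lemma radial_potential_derive2E i j : 'D_(e j) ('D_(e i) radial_potential) =
  (fun x => - P (r x) * (i == j)%:R - Q x * x ord0 i * x ord0 j).
Proof.
by apply/funext => x; have [_ ->] := radial_potential_derive2 i j x.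
Qed.

Lemma laplacian_radial_potential x : laplacian radial_potential x = - g (r x).
Proof.
have -> : laplacian radial_potential x =
    \sum_i (- P (r x) - Q x * x ord0 i * x ord0 i).
  apply: eq_bigr => i _; have [_ ->] := radial_potential_derive2 i i x.
  by rewrite eqxx mulr1.
rewrite big_split/= sumr_const card_ord sumrN.
under eq_bigr do rewrite -mulrA -expr2.
rewrite -mulr_sumr -enorm_sqr /Q.
have [->|x0] := eqVneq (r x) 0.
  by rewrite expr0n/= mulr0 subr0 /slope ltxx -[LHS]mulr_natr mulNr divfK.
by rewrite divfK ?expf_neq0// -[X in X - _]mulr_natr; ring.
Qed.

Let P_continuous : continuous (fun x => P (r x)).
Proof.
move=> x; apply: continuous_comp; first exact: enorm_continuous.
exact: slope_continuous.
Qed.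

Let coord_cont i : continuous (fun x : 'rV[R]_n.+1 => x ord0 i).
Proof. by move=> x; exact: coord_continuous. Qed.

(** At the origin the direction-dependent factor x_i x_j / |x|^2 is bounded by 1
and multiplies g - (n + 1) slope, which vanishes there. *)
Lemma radial_hessian_continuous i j :
  continuous (fun x => - P (r x) * (i == j)%:R - Q x * x ord0 i * x ord0 j).
Proof.
move=> x.
suff c2 : {for x, continuous (fun x => Q x * x ord0 i * x ord0 j)}.
  exact: (cvgB (cvgM (cvgN (@P_continuous x)) (cvg_cst _)) c2).
have cd : continuous (fun x => g (r x) - n.+1%:R * P (r x)).
  move=> z; have c1 : {for z, continuous (g \o @enorm R n.+1)}.
    by apply: continuous_comp; [exact: enorm_continuous|exact: cg].
  exact: (cvgB c1 (cvgM (cvg_cst _) (@P_continuous z))).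
have [x0|x0] := eqVneq x 0; last first.
  have r0 : enorm x ^+ 2 != 0 by rewrite expf_neq0// enorm_eq0.
  have c1 := @enorm_continuous R n.+1 x.
  have c2 : {for x, continuous (fun x => enorm x ^+ 2)} by exact: (cvgM c1 c1).
  exact: (cvgM (cvgM (cvgM (cd x) (cvgV r0 c2)) (@coord_cont i x)) (@coord_cont j x)).
suff H0 : Q y * y ord0 i * y ord0 j @[y --> (0 : 'rV[R]_n.+1)] -->
    Q 0 * (0 : 'rV[R]_n.+1) ord0 i * (0 : 'rV[R]_n.+1) ord0 j.
  by rewrite x0; exact: H0.
have -> : Q 0 * (0 : 'rV[R]_n.+1) ord0 i * (0 : 'rV[R]_n.+1) ord0 j = 0.
  by rewrite !mxE mulr0.
apply/(@cvgrPdist_le _ _ _ (nbhs (0 : 'rV[R]_n.+1)) (nbhs_filter _)) => eps eps0.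
have d0 : g (r 0) - n.+1%:R * P (r 0) = 0.
  by rewrite enorm0 /slope ltxx mulrC divfK ?subrr.
have := cd 0; rewrite /continuous_at d0 => /cvgrPdist_le/(_ _ eps0).
apply: filterS => z; rewrite !sub0r !normrN /Q => h.
apply: le_trans h; have [->|z0] := eqVneq (r z) 0.
  by rewrite expr0n/= invr0 mulr0 !mul0r normr0 normr_ge0.
have z1 : 0 < r z by rewrite lt_def z0 enorm_ge0.
rewrite -!mulrA normrM ler_piMr//.
rewrite normrM normfV normrX (ger0_norm (enorm_ge0 z)) mulrC.
rewrite ler_pdivrMr ?exprn_gt0// mul1r normrM expr2.
by rewrite ler_pM// coord_le_enorm.
Qed.

Lemma radial_potential_test : test_function radial_potential.
Proof.
split.
- apply: continuous_subspaceT => x.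
  apply: (@continuous_comp _ _ _ (fun x => enorm x ^+ 2) (potential n g)).
    by have ce := @enorm_continuous R n.+1 x; exact: (cvgM ce ce).
  apply: is_derive_continuous (potential_derive n cg _).
  by have := sqr_ge0 (enorm x); lra.
- by move=> x x1; rewrite /radial_potential x1 expr1n potential1.
- by move=> i x _; case: (radial_potential_derive i x).
- by move=> i j x _; case: (radial_potential_derive2 i j x).
split=> [i|i j]; apply: extension_within; apply: continuous_subspaceT => x.
  rewrite radial_potential_deriveE.
  exact: (cvgM (cvgN (@P_continuous x)) (@coord_cont i x)).
by rewrite radial_potential_derive2E; exact: radial_hessian_continuous.
Qed.

End radial_test_function.

(** * Regular nonlinearities *)

Section regular_nonlinearity_theory.
Context {R : realType}.
Variable F : R -> R.
Hypothesis rF : regular_nonlinearity F.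

Lemma nonlinearity_mono (s t : R) : 0 <= s -> s <= t -> F s <= F t.
Proof. by move=> s0 st; case: rF => _ h _ _ _; exact: h. Qed.

Lemma nonlinearity_ge1 (t : R) : 0 <= t -> 1 <= F t.
Proof. by move=> t0; case: rF => _ _ _ <- _; exact: nonlinearity_mono. Qed.

Lemma nonlinearity_derivable (t : R) : 0 < t -> is_derive t 1 F (derive1 F t).
Proof.
case: rF => -[_ dF _] _ _ _ _ t0.
by apply: DeriveDef; [exact: (dF 0%N)|rewrite derive1E].
Qed.

(** F is only meaningful on the nonnegative reals; this extension is continuous and
nondecreasing on the whole line. *)
Definition nonneg_extension (t : R) : R := F (Num.max t 0).

Lemma nonneg_extensionE (t : R) : 0 <= t -> nonneg_extension t = F t.
Proof. by move=> t0; rewrite /nonneg_extension max_l. Qed.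

Lemma nonneg_extension_continuous : continuous nonneg_extension.
Proof.
case: rF => -[cF _ _] _ _ _ _ t.
have mt0 : `[0, +oo[%classic (Num.max t 0) by rewrite /= in_itv/= le_max lexx orbT.
have /subspace_continuousP/(_ _ mt0) H := cF.
have cm : {for t, continuous (fun s : R => Num.max s 0)}.
  apply: (@continuous_max _ R (fun s => s) (fun=> 0)) => //.
  exact: cvg_cst.
move=> U FU; have HU := H U FU.
have H2 : \forall s \near nbhs t,
    `[0, +oo[%classic (Num.max s 0) -> U (F (Num.max s 0)) by exact: (cm _ HU).
suff H3 : \forall s \near nbhs t, U (F (Num.max s 0)) by exact: H3.
apply: filterS H2 => s; apply.
by rewrite /= in_itv/= le_max lexx orbT.
Qed.

Lemma nonneg_extension_mono (s t : R) :
  s <= t -> nonneg_extension s <= nonneg_extension t.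
Proof.
move=> st; apply: nonlinearity_mono; first by rewrite le_max lexx orbT.
by rewrite ge_max !le_max st lexx orbT.
Qed.

Lemma nonneg_extension_ge1 (t : R) : 1 <= nonneg_extension t.
Proof. by apply: nonlinearity_ge1; rewrite le_max lexx orbT. Qed.

(** At 0 the derivative of F is replaced by the right limit provided by smoothness. *)
Definition nonneg_derivative (t : R) : R :=
  if 0 < t then derive1 F t else lim (derive1 F x @[x --> 0^'+]).

Lemma nonneg_derivative_right :
  derive1 F x @[x --> 0^'+] --> nonneg_derivative 0.
Proof. by rewrite /nonneg_derivative ltxx; case: rF => -[_ _ /(_ 1%N)]. Qed.

Lemma nonneg_derivative_continuous : continuous nonneg_derivative.
Proof.
move=> t; have [t0|t0|->] := ltgtP t 0.
- apply: is_derive_continuous (near_eq_is_derive _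
    (is_derive_cst_fun (lim (derive1 F x @[x --> 0^'+])) t)).
  near=> x; rewrite /nonneg_derivative ifF//; apply/negbTE; rewrite -leNgt ltW//.
  near: x; exact: lt_nbhsl.
- have d2 : is_derive t 1 (derive1 F) (derive1 (derive1 F) t).
    case: rF => -[_ dF _] _ _ _ _.
    by apply: DeriveDef; [exact: (dF 1%N)|rewrite derive1E].
  apply: is_derive_continuous (near_eq_is_derive _ d2).
  near=> x; rewrite /nonneg_derivative ifT//; near: x; exact: lt_nbhsr.
- apply/(@cvgrPdist_le _ _ _ (nbhs (0 : R)) (nbhs_filter _)) => e e0.
  have /cvgrPdist_le/(_ _ e0) := nonneg_derivative_right.
  move=> [d /= d0 Hd]; near=> x.
  have [x0|x0] := leP x 0.
    by rewrite /nonneg_derivative ltxx ltNge x0/= subrr normr0 ltW.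
  have xd : x < d by near: x; exact: lt_nbhsl.
  rewrite [X in _ - X]/nonneg_derivative x0; apply: Hd => //=.
Unshelve. all: by end_near. Qed.

(** The difference quotients of F at t in the direction of s are at most F s - F t,
by convexity. *)
Lemma tangent_below_pos (s t : R) : 0 <= s -> 0 < t ->
  F t + derive1 F t * (s - t) <= F s.
Proof.
move=> s0 t0.
have [_ _ cF _ _] := rF.
have d := nonlinearity_derivable t0.
have dl : is_derive (0 : R) 1 (fun h : R => F (t + h * (s - t)))
    (derive1 F t * (s - t)).
  have d1 : is_derive (0 : R) 1 (fun h : R => t + h * (s - t)) (s - t).
    apply: is_derive_eq (is_deriveD_fun (is_derive_cst_fun t (0 : R))
      (is_deriveM_fun (is_derive_id_fun (0 : R)) (is_derive_cst_fun (s - t) (0 : R)))) _.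
    by ring.
  have d0 : is_derive (t + 0 * (s - t)) 1 F (derive1 F t) by rewrite mul0r addr0.
  exact: (@is_derive1_comp R F (fun h : R => t + h * (s - t)) 0 _ _ d0 d1).
have [dd dE] := dl.
suff : derive1 F t * (s - t) <= F s - F t by lra.
have dcv : h^-1 * (F (t + h * (s - t)) - F t) @[h --> (0:R)^'] -->
    derive1 F t * (s - t).
  rewrite -dE /derive; rewrite (_ : (fun h => h^-1 * _) = (fun h : R =>
    h^-1 *: (((fun h : R => F (t + h * (s - t))) \o shift 0) (h *: (1:R)) -
      F (t + 0 * (s - t))))); first exact: dd.
  by apply/funext => h; rewrite /= /shift /= addr0 mul0r addr0 [h *: 1]mulr1.
have dcv' : h^-1 * (F (t + h * (s - t)) - F t) @[h --> (0:R)^'+] -->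
    derive1 F t * (s - t).
  move=> U lU.
  have H2 : \forall h \near (0:R), h != 0 -> U (h^-1 * (F (t + h * (s - t)) - F t)).
    exact: (dcv U lU).
  suff H3 : \forall h \near (0:R), 0 < h -> U (h^-1 * (F (t + h * (s - t)) - F t)).
    exact: H3.
  by apply: filterS H2 => h H h0; apply: H; rewrite gt_eqF.
apply: (cvgr_to_le dcv'); near=> h.
have h0 : 0 < h by near: h; exact: nbhs_right_gt.
have h1 : h <= 1 by near: h; exact: nbhs_right_le.
have /(_ s t) := cF (Itv01 (ltW h0) h1); rewrite !inE /= !in_itv/= s0 (ltW t0).
move=> /(_ isT isT) Hc0.
have : F (h * s + (1 - h) * t) <= h * F s + (1 - h) * F t by exact: Hc0.
rewrite (_ : h * s + (1 - h) * t = t + h * (s - t)); last by ring.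
move=> Hc; rewrite mulrC ler_pdivrMr//; lra.
Unshelve. all: by end_near. Qed.

Lemma nonneg_derivative_ge0 (t : R) : 0 <= nonneg_derivative t.
Proof.
have H (x : R) : 0 < x -> 0 <= derive1 F x.
  move=> x0; have := tangent_below_pos (lexx 0) x0.
  have := nonlinearity_mono (lexx 0) (ltW x0).
  rewrite sub0r => h1 h2; have : 0 <= derive1 F x * x by lra.
  by rewrite pmulr_lge0.
have H0 : 0 <= nonneg_derivative 0.
  apply: (cvgr_to_ge nonneg_derivative_right); near=> x; apply: H.
  by near: x; exact: nbhs_right_gt.
rewrite /nonneg_derivative ltxx in H0; rewrite /nonneg_derivative.
by case: ifPn => // t0; exact: H.
Unshelve. all: by end_near. Qed.

Lemma tangent_below (s t : R) : 0 <= s -> 0 <= t ->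
  F t + nonneg_derivative t * (s - t) <= F s.
Proof.
move=> s0; rewrite le_eqVlt => /predU1P[<-|t0]; last first.
  by rewrite /nonneg_derivative t0; exact: tangent_below_pos.
have cF : F x @[x --> 0^'+] --> F 0.
  have := @nonneg_extension_continuous 0.
  rewrite /continuous_at (nonneg_extensionE (lexx 0)) => /cvg_at_right_filter.
  apply: cvg_trans; apply: near_eq_cvg; near=> x.
  by rewrite max_l//; near: x; exact: nbhs_right_ge.
have cx : s - x @[x --> (0:R)^'+] --> s - 0.
  by apply: cvgB; [exact: cvg_cst|exact: cvg_at_right_filter].
apply: (cvgr_to_le (cvgD cF (cvgM nonneg_derivative_right cx))).
near=> x; apply: tangent_below_pos => //; near: x; exact: nbhs_right_gt.
Unshelve. all: by end_near. Qed.

Lemma nonneg_derivative_pos (t : R) : 0 < t ->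
  is_derive t 1 F (nonneg_derivative t).
Proof. by move=> t0; rewrite /nonneg_derivative t0; exact: nonlinearity_derivable. Qed.

Lemma superlinear (K : R) : exists2 M, 0 <= M & forall t, 0 < t -> F t <= K * t -> t <= M.
Proof.
case: rF => _ _ _ _ /cvgryPge/(_ (K + 1)) [M [Mr HM]].
exists (Num.max 0 M); first by rewrite le_max lexx.
move=> t t0 Ft; rewrite leNgt; apply/negP; rewrite gt_max => /andP[_ /HM].
rewrite ler_pdivlMr//; lra.
Qed.

End regular_nonlinearity_theory.

(** * Monotone iteration for the radial problem *)

Section radial_iteration.
Context {R : realType}.
Variables (n : nat) (al : R) (F : R -> R).
Hypothesis al0 : 0 <= al.
Hypothesis rF : regular_nonlinearity F.

(** Clamping the radius to [0, 1] makes the iterates continuous, nonnegative and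
bounded on the whole line. *)
Definition clamp (r : R) : R := Num.max (Num.min r 1) 0.

Lemma clamp_itv (r : R) : 0 <= clamp r <= 1.
Proof. by rewrite /clamp le_max lexx orbT ge_max ler01 ge_min lexx orbT. Qed.

Lemma clampE (r : R) : 0 <= r <= 1 -> clamp r = r.
Proof. by move=> /andP[r0 r1]; rewrite /clamp min_l// max_l. Qed.

Lemma clamp_continuous : continuous clamp.
Proof.
move=> r; apply: (@continuous_max _ R (fun s => Num.min s 1) (fun=> 0)).
  apply: (@continuous_min _ R (fun s => s) (fun=> 1)) => //.
  exact: cvg_cst.
exact: cvg_cst.
Qed.

Definition weight (r : R) : R := clamp r `^ al.

Lemma weight_ge0 (r : R) : 0 <= weight r. Proof. exact: powR_ge0. Qed.

Lemma weight_le1 (r : R) : weight r <= 1.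
Proof.
have /andP[c0 c1] := clamp_itv r.
apply: (@le_trans _ _ (1 `^ al)); last by rewrite powR1.
by rewrite /weight ge0_ler_powR// nnegrE.
Qed.

(** For alpha = 0 the weight is constantly 1, also at 0. *)
Lemma weight_continuous : continuous weight.
Proof.
move=> r; have [a0|a0] := eqVneq al 0.
  rewrite /weight a0 (_ : (fun r => _) = (fun=> 1)); first exact: cvg_cst.
  by apply/funext => s; rewrite powRr0.
have ap : 0 < al by rewrite lt_def a0.
apply/(@cvgrPdist_le _ _ _ (nbhs r) (nbhs_filter _)) => e e0.
have /andP[c0 c1] := clamp_itv r.
move: c0; rewrite le_eqVlt => /predU1P[c0|c0].
  have /cvgrPdist_le/(_ _ e0)[d /= d0 Hd] := powR_cvg0 ap.
  have /cvgrPdist_lt/(_ _ d0) := @clamp_continuous r.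
  apply: filterS => x; rewrite /weight -c0 powR0// !sub0r !normrN => xd.
  have /andP[] := clamp_itv x; rewrite le_eqVlt => /predU1P[<- _|x0 _].
    by rewrite powR0// normr0 ltW.
  by have := Hd (clamp x); rewrite /= !sub0r !normrN; apply.
have cp : {for clamp r, continuous (fun t : R => t `^ al)}.
  exact: is_derive_continuous (is_derive_powR_fun al c0).
have := @continuous_comp _ _ _ clamp (fun t : R => t `^ al) r (@clamp_continuous r) cp.
by move=> /cvgrPdist_le/(_ _ e0).
Qed.

Definition source (lam : R) (V : R -> R) (r : R) : R :=
  lam * weight r * nonneg_extension F (V r).

Fixpoint iterate (lam : R) (k : nat) : R -> R :=
  if k is m.+1 then
    fun r => potential n (source lam (iterate lam m)) (clamp r ^+ 2)
  else fun=> 0.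

Lemma source_continuous lam V : continuous V -> continuous (source lam V).
Proof.
move=> cV r.
have c1 : {for r, continuous (nonneg_extension F \o V)}.
  by apply: continuous_comp; [exact: cV|exact: nonneg_extension_continuous].
exact: (cvgM (cvgM (cvg_cst lam) (@weight_continuous r)) c1).
Qed.

Lemma source_ge0 lam V r : 0 <= lam -> 0 <= source lam V r.
Proof.
move=> l0; rewrite /source mulr_ge0//; first by rewrite mulr_ge0// weight_ge0.
exact: le_trans (nonneg_extension_ge1 rF _).
Qed.

Lemma source_mono lam lam' V V' r : 0 <= lam -> lam <= lam' -> V r <= V' r ->
  source lam V r <= source lam' V' r.
Proof.
move=> l0 ll VV; rewrite /source; apply: ler_pM.
- by rewrite mulr_ge0// weight_ge0.
- exact: le_trans (nonneg_extension_ge1 rF _).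
- by rewrite ler_wpM2r// weight_ge0.
- exact: nonneg_extension_mono.
Qed.

Lemma potential_clamp_continuous g : continuous g ->
  continuous (fun r => potential n g (clamp r ^+ 2)).
Proof.
move=> cg r.
apply: (@continuous_comp _ _ _ (fun r => clamp r ^+ 2) (potential n g)).
  have c1 := @clamp_continuous r; exact: (cvgM c1 c1).
apply: is_derive_continuous (potential_derive n cg _).
by have := sqr_ge0 (clamp r); lra.
Qed.

Lemma iterate_continuous lam k : continuous (iterate lam k).
Proof.
elim: k => [|k IH] /=; first by move=> r; exact: cvg_cst.
by apply: potential_clamp_continuous; exact: source_continuous.
Qed.

Lemma iterate_ge0 lam k r : 0 <= lam -> 0 <= iterate lam k r.
Proof.
move=> l0; case: k => //= k; apply: potential_ge0.
- by apply: source_continuous; exact: iterate_continuous.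
- by move=> x _; exact: source_ge0.
- exact: clamp_itv.
Qed.

Lemma iterate_antitone lam k s t : 0 <= lam -> 0 <= s -> s <= t -> t <= 1 ->
  iterate lam k t <= iterate lam k s.
Proof.
move=> l0 s0 st t1; case: k => //= k.
rewrite !clampE; [|lra|lra].
apply: potential_antitone => //.
- by apply: source_continuous; exact: iterate_continuous.
- by move=> x _; exact: source_ge0.
Qed.

Lemma iterate_mono lam lam' k r : 0 <= lam -> lam <= lam' ->
  iterate lam k r <= iterate lam' k r.
Proof.
move=> l0 ll; elim: k r => //= k IH r; apply: potential_mono.
- by apply: source_continuous; exact: iterate_continuous.
- by apply: source_continuous; exact: iterate_continuous.
- by move=> x _; exact: source_mono.
- exact: clamp_itv.
Qed.

Lemma iterate_nondecreasing lam r : 0 <= lam ->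
  nondecreasing_seq (fun k => iterate lam k r).
Proof.
move=> l0; apply/nondecreasing_seqP => k; elim: k r => [|k IH] r.
  exact: iterate_ge0.
apply: (@potential_mono _ n (source lam (iterate lam k))
  (source lam (iterate lam k.+1))).
- by apply: source_continuous; exact: iterate_continuous.
- by apply: source_continuous; exact: iterate_continuous.
- by move=> x _; exact: source_mono.
- exact: clamp_itv.
Qed.

Definition radial_solution (lam r : R) : R := lim (iterate lam k r @[k --> \oo]).

Section bounded_iterates.
Variables (lam M : R).
Hypotheses (l0 : 0 <= lam) (iM : forall k r, iterate lam k r <= M).

Lemma iterate_cvg r : iterate lam k r @[k --> \oo] --> radial_solution lam r.
Proof.
apply: nondecreasing_is_cvgn; first exact: iterate_nondecreasing.
by exists M => _ [k _ <-].
Qed.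

Lemma iterate_le_solution k r : iterate lam k r <= radial_solution lam r.
Proof.
apply: nondecreasing_cvgn_le; first exact: iterate_nondecreasing.
by apply/cvg_ex; eexists; exact: iterate_cvg.
Qed.

Lemma radial_solution_le r : radial_solution lam r <= M.
Proof. by apply: (cvgr_to_le (@iterate_cvg r)); exact: nearW. Qed.

Lemma radial_solution_ge0 r : 0 <= radial_solution lam r.
Proof. exact: iterate_le_solution 0%N r. Qed.

Lemma source_iterate_bound k r :
  0 <= source lam (iterate lam k) r <= lam * nonneg_extension F M.
Proof.
rewrite source_ge0//= /source; apply: ler_pM.
- by rewrite mulr_ge0// weight_ge0.
- exact: le_trans (nonneg_extension_ge1 rF _).
- by rewrite ler_piMr// weight_le1.
- exact: nonneg_extension_mono.
Qed.

(** The iterates are equi-Lipschitz, since their sources are uniformly bounded. *)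
Lemma radial_solution_continuous : continuous (radial_solution lam).
Proof.
pose K := lam * nonneg_extension F M.
have K0 : 0 <= K.
  by rewrite mulr_ge0//; exact: le_trans (nonneg_extension_ge1 rF _).
have lip k s t : `|iterate lam k s - iterate lam k t| <= K * `|clamp s - clamp t|.
  case: k => [|k] /=; first by rewrite subrr normr0 mulr_ge0.
  have cs : continuous (source lam (iterate lam k)).
    by apply: source_continuous; exact: iterate_continuous.
  have /andP[s0 s1] := clamp_itv s; have /andP[t0 t1] := clamp_itv t.
  have [st|ts] := leP (clamp s) (clamp t).
    rewrite (distrC (clamp s)) (ger0_norm (x := clamp t - clamp s)) ?subr_ge0//.
    exact (potential_lipschitz n cs (source_iterate_bound k) s0 st t1).
  rewrite distrC (ger0_norm (x := clamp s - clamp t)) ?subr_ge0 ?(ltW ts)//.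
  exact (potential_lipschitz n cs (source_iterate_bound k) t0 (ltW ts) s1).
have lipV s t : `|radial_solution lam s - radial_solution lam t| <=
    K * `|clamp s - clamp t|.
  have H : `|iterate lam k s - iterate lam k t| @[k --> \oo] -->
      `|radial_solution lam s - radial_solution lam t|.
    by apply: cvg_norm; apply: cvgB; exact: iterate_cvg.
  by apply: (cvgr_to_le H); apply: nearW => k; exact: lip.
move=> r; apply/(@cvgrPdist_le _ _ _ (nbhs r) (nbhs_filter _)) => e e0.
have eK : 0 < e / (K + 1) by rewrite divr_gt0//; lra.
have /cvgrPdist_le/(_ _ eK) := @clamp_continuous r.
apply: filterS => x h; apply: (le_trans (lipV _ _)).
apply: (@le_trans _ _ ((K + 1) * (e / (K + 1)))).
  by apply: ler_pM => //; lra.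
by rewrite mulrC divfK// gt_eqF//; lra.
Qed.

Lemma radial_solution_fixpoint r : radial_solution lam r =
  potential n (source lam (radial_solution lam)) (clamp r ^+ 2).
Proof.
have h1 : iterate lam k.+1 r @[k --> \oo] --> radial_solution lam r.
  by have := @iterate_cvg r; rewrite -(cvg_shiftS (fun k => iterate lam k r)).
have h2 : iterate lam k.+1 r @[k --> \oo] -->
    potential n (source lam (radial_solution lam)) (clamp r ^+ 2).
  rewrite /=; apply: (@potential_cvg _ _ _ _ (lam * nonneg_extension F M)).
  - by move=> k; apply: source_continuous; exact: iterate_continuous.
  - by apply: source_continuous; exact: radial_solution_continuous.
  - exact: source_iterate_bound.
  - move=> t; apply: cvgM; first exact: cvg_cst.
    apply: (@cvg_comp _ _ _ (fun k => iterate lam k t) (nonneg_extension F)).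
      exact: iterate_cvg.
    exact: nonneg_extension_continuous.
  - exact: clamp_itv.
exact: cvg_unique h1 h2.
Qed.

End bounded_iterates.

Lemma radial_solution_mono lam lam' M r : 0 <= lam -> lam <= lam' ->
  (forall k r, iterate lam' k r <= M) ->
  radial_solution lam r <= radial_solution lam' r.
Proof.
move=> l0 ll iM; have l0' : 0 <= lam' by exact: le_trans ll.
have iM' k s : iterate lam k s <= M.
  exact: le_trans (iterate_mono _ _ l0 ll) (iM _ _).
apply: (cvgr_to_le (iterate_cvg l0 iM' (r := r))); apply: nearW => k.
apply: (le_trans (iterate_mono k r l0 ll)).
exact: (iterate_le_solution l0' iM).
Qed.

End radial_iteration.

(** * Essentially bounded functions on the ball *)

Section ae_bounded.
Context {R : realType} {N : nat}.
Local Notation B := (unit_ball R N).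
Local Notation mu := (lebesgue_rV R N).
Implicit Types f g u : 'rV[R]_N -> R.

Let mB : measurable B. Proof. exact: measurable_unit_ball. Qed.

Definition ae_bounded f : Prop := measurable_fun B f /\
  exists K, {ae mu, forall x, B x -> `|f x| <= K}.

Lemma ae_bounded_integrable f : ae_bounded f -> mu.-integrable B (EFin \o f).
Proof.
move=> [mf [K fK]]; exact: (bounded_integrable mB unit_ball_finite mf fK).
Qed.

Lemma ae_boundedM f g : ae_bounded f -> ae_bounded g ->
  ae_bounded (fun x => f x * g x).
Proof.
move=> [mf [K fK]] [mg [L gL]]; split; first exact: measurable_funM.
exists (K * L); move: fK gL; apply: filterS2 => x h1 h2 Bx.
by rewrite normrM ler_pM// ?h1// h2.
Qed.

Lemma ae_boundedD f g : ae_bounded f -> ae_bounded g ->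
  ae_bounded (fun x => f x + g x).
Proof.
move=> [mf [K fK]] [mg [L gL]]; split; first exact: measurable_funD.
exists (K + L); move: fK gL; apply: filterS2 => x h1 h2 Bx.
by apply: (le_trans (ler_normD _ _)); rewrite lerD// ?h1// h2.
Qed.

Lemma ae_boundedN f : ae_bounded f -> ae_bounded (fun x => - f x).
Proof.
move=> [mf [K fK]]; split; first exact: measurableT_comp.
by exists K; move: fK; apply: filterS => x h Bx; rewrite normrN h.
Qed.

Lemma ae_bounded_extension f : extends_to_closed_ball f -> ae_bounded f.
Proof.
move=> fE; split; first exact: extension_measurable.
by have [K _ fK] := extension_bounded fE; exists K; exact: aeW.
Qed.

Lemma ae_bounded_radial (h : R -> R) : continuous h ->
  ae_bounded (fun x => h (enorm x)).
Proof.
move=> ch; split.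
  apply: continuous_measurable_rV => // x.
  by apply: continuous_comp; [exact: enorm_continuous|exact: ch].
have [K _ hK] : exists2 K, 0 <= K & forall t, 0 <= t <= 1 -> `|h t| <= K.
  have ch' : {within `[0, 1], continuous h} by exact: continuous_subspaceT.
  have [c _ fc] := @EVT_max R h 0 1 ler01 ch'.
  have [e _ fe] := @EVT_min R h 0 1 ler01 ch'.
  exists (`|h c| + `|h e|); first by rewrite addr_ge0.
  move=> t t01.
  have := fc t; have := fe t; rewrite in_itv/= t01 => /(_ isT) h1 /(_ isT) h2.
  have := ler_norm (h c); have := ler_norm (- h e); rewrite normrN.
  have := normr_ge0 (h c); have := normr_ge0 (h e).
  by rewrite ler_norml; lra.
exists K; apply: aeW => x Bx; apply: hK.
by rewrite enorm_ge0 ltW.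
Qed.

Lemma ae_le_Rintegral f g : ae_bounded f -> ae_bounded g ->
  {ae mu, forall x, B x -> f x <= g x} ->
  \int[mu]_(x in B) f x <= \int[mu]_(x in B) g x.
Proof.
move=> bf bg fg; have If := ae_bounded_integrable bf.
have Ig := ae_bounded_integrable bg.
rewrite -subr_ge0 -RintegralB//.
have [mgf _] := ae_boundedD bg (ae_boundedN bf).
rewrite [leRHS](_ : _ = \int[mu]_(x in B) `|g x - f x|).
  exact: Rintegral_ge0.
congr fine; apply: ae_eq_integral => //.
- exact/measurable_EFinP.
- by apply/measurable_EFinP; exact: measurableT_comp.
- move: fg; apply: filterS => x h Bx.
  by rewrite ger0_norm// subr_ge0 h.
Qed.

Lemma lebesgue_rV_setT_gt0 : (0 < mu setT)%E.
Proof.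
apply: (lt_le_trans (@small_ball_pos R N 1 ltr01)).
by apply: le_measure; rewrite ?inE//; exact: measurable_unit_ball.
Qed.

(** The norm is that of the extension of u by zero, and it is 0 by convention on a
null space, a case excluded by [lebesgue_rV_setT_gt0]. *)
Lemma ess_bounded u : ('N[mu]_+oo [EFin \o (u \_ B)] < +oo)%E ->
  exists2 M, 0 <= M & {ae mu, forall x, B x -> `|u x| <= M}.
Proof.
rewrite unlock /= lebesgue_rV_setT_gt0 => h.
have := @ess_sup_ge _ _ _ mu (abse \o (EFin \o u \_ B)).
move: h; case: (ess_sup _ _) => [M _ HM|//|_ HM].
  exists `|M| => //; move: HM; apply: filterS => x /= h Bx.
  move: h; rewrite patchE mem_set// lee_fin => h.
  by apply: (le_trans h); exact: ler_norm.
exists 0 => //; move: HM; apply: filterS => x /= h Bx.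
by move: h; rewrite leeNy_eq.
Qed.

Lemma bounded_ess u (M : R) : {ae mu, forall x, B x -> `|u x| <= M} ->
  ('N[mu]_+oo [EFin \o (u \_ B)] < +oo)%E.
Proof.
move=> uM; rewrite unlock /= lebesgue_rV_setT_gt0.
apply: (@le_lt_trans _ _ `|M|%:E); last by rewrite ltry.
apply/ess_supP; move: uM; apply: filterS => x h /=.
rewrite lee_fin patchE; case: ifPn => [|_]; last by rewrite normr0.
by rewrite inE => /h h1; apply: (le_trans h1); exact: ler_norm.
Qed.

End ae_bounded.

(** * Bounded solutions dominate the radial iterates *)

Section comparison.
Context {R : realType} {n : nat}.
Variables (al : R) (F : R -> R).
Hypothesis al0 : 0 <= al.
Hypothesis rF : regular_nonlinearity F.
Local Notation B := (unit_ball R n.+1).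
Local Notation mu := (lebesgue_rV R n.+1).
Local Notation r x := (@enorm R n.+1 x).
Local Notation Fp := (nonneg_extension F).

Let mB : measurable B. Proof. exact: measurable_unit_ball. Qed.

Lemma ball_radius (x : 'rV[R]_n.+1) : B x -> 0 <= r x <= 1.
Proof. by move=> Bx; rewrite enorm_ge0 ltW. Qed.

Lemma clamp_enorm (x : 'rV[R]_n.+1) : B x -> clamp (r x) = r x.
Proof. by move=> /ball_radius /clampE. Qed.

Lemma weight_enorm (x : 'rV[R]_n.+1) : B x -> weight al (r x) = r x `^ al.
Proof. by move=> Bx; rewrite /weight clamp_enorm. Qed.

Lemma ae_bounded_nonlinearity (u : 'rV[R]_n.+1 -> R) :
  ae_bounded u -> ae_bounded (fun x => Fp (u x)).
Proof.
move=> [mu' [K uK]]; split.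
  apply: measurableT_comp => //; apply: continuous_measurable_fun.
  exact: nonneg_extension_continuous.
exists (Fp K); move: uK; apply: filterS => x h Bx.
rewrite ger0_norm; last by exact: le_trans (nonneg_extension_ge1 rF _).
by apply: nonneg_extension_mono => //; apply: (le_trans (ler_norm _)); exact: h.
Qed.

Section one_solution.
Variables (lam : R) (u : 'rV[R]_n.+1 -> R).
Hypotheses (l0 : 0 <= lam) (su : classical_solution al F lam u).

Lemma classical_ae_bounded : ae_bounded u.
Proof.
have [[_ iu _ _] /ess_bounded[M _ uM]] := su.
split; last by exists M.
by have /integrableP[/measurable_EFinP] := iu.
Qed.

Let bu := classical_ae_bounded.

(** Induction on k. With phi the radial potential of chi, the weak equation for u
and Green's identity for V_(k+1) turn the integral into that of
lam |x|^alpha (F(u) - F(V_k)) phi. By convexity this is at least the integral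
of u - V_k against lam |x|^alpha F'(V_k) phi, a nonnegative continuous radial
weight, so the induction hypothesis applies. *)
Lemma iterate_comparison k (chi : R -> R) : continuous chi ->
  (forall t, 0 <= chi t) ->
  0 <= \int[mu]_(x in B) ((u x - iterate n al F lam k (r x)) * chi (r x)).
Proof.
have [[u0 _ _ weak] _] := su.
elim: k chi => [|k IH] chi cchi chi0.
  apply: Rintegral_ge0 => x Bx.
  by rewrite /= subr0 mulr_ge0// u0.
pose V := iterate n al F lam k.
have cV : continuous V by exact: iterate_continuous.
pose S := source al F lam V.
have cS : continuous S by exact: source_continuous.
pose phi := @radial_potential R n chi.
have tphi : test_function phi by exact: radial_potential_test.
have tS : test_function (@radial_potential R n S) by exact: radial_potential_test.
have phi0 x : B x -> 0 <= phi x.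
  move=> /ball_radius Bx; rewrite /phi /radial_potential.
  exact: potential_ge0.
have bphi : ae_bounded phi.
  by apply: ae_bounded_extension; exact: test_extension.
have bchi : ae_bounded (fun x => chi (r x)) by exact: ae_bounded_radial.
have bw : ae_bounded (fun x => lam * weight al (r x)).
  apply: (ae_bounded_radial (h := fun t => lam * weight al t)) => t.
  by apply: cvgM; [exact: cvg_cst|exact: weight_continuous].
have bV1 : ae_bounded (fun x => iterate n al F lam k.+1 (r x)).
  by apply: ae_bounded_radial; exact: iterate_continuous.
have bV : ae_bounded (fun x => V (r x)) by exact: ae_bounded_radial.
have bFu := ae_bounded_nonlinearity bu.
have bFV := ae_bounded_nonlinearity bV.
have EA : \int[mu]_(x in B) (u x * chi (r x)) =
    \int[mu]_(x in B) (lam * weight al (r x) * Fp (u x) * phi x).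
  transitivity (\int[mu]_(x in B) (u x * - laplacian phi x)).
    by apply: eq_Rintegral => x _; rewrite laplacian_radial_potential ?opprK.
  rewrite weak//; apply: eq_Rintegral => x; rewrite inE => Bx.
  by rewrite weight_enorm// nonneg_extensionE ?u0.
have EB : \int[mu]_(x in B) (iterate n al F lam k.+1 (r x) * chi (r x)) =
    \int[mu]_(x in B) (lam * weight al (r x) * Fp (V (r x)) * phi x).
  transitivity (\int[mu]_(x in B) (@radial_potential R n S x * - laplacian phi x)).
    apply: eq_Rintegral => x; rewrite inE => Bx.
    rewrite laplacian_radial_potential ?opprK//; congr (_ * _).
    by rewrite /= clamp_enorm.
  rewrite green_identity//; apply: eq_Rintegral => x _.
  by rewrite laplacian_radial_potential// opprK mulrC.
under eq_Rintegral do rewrite mulrBl.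
rewrite RintegralB//; [|exact/ae_bounded_integrable/ae_boundedM..].
rewrite EA EB.
pose chi' t := lam * weight al t * nonneg_derivative F (V t) *
  potential n chi (clamp t ^+ 2).
have cchi' : continuous chi'.
  move=> t; have c1 : {for t, continuous (nonneg_derivative F \o V)}.
    by apply: continuous_comp; [exact: cV|exact: nonneg_derivative_continuous].
  have c2 := @potential_clamp_continuous R n chi cchi t.
  exact: (cvgM (cvgM (cvgM (cvg_cst lam) (weight_continuous al0 (x := t))) c1) c2).
have chi'0 t : 0 <= chi' t.
  rewrite /chi' mulr_ge0//; last first.
    by apply: potential_ge0 => //; exact: clamp_itv.
  by rewrite mulr_ge0// ?nonneg_derivative_ge0// mulr_ge0// weight_ge0.
have := IH _ cchi' chi'0; rewrite -/V => IH'.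
rewrite -RintegralB//; [|exact/ae_bounded_integrable/ae_boundedM/bphi/ae_boundedM..].
apply: (le_trans IH'); apply: ae_le_Rintegral.
- apply: ae_boundedM; last exact: ae_bounded_radial.
  by apply: ae_boundedD => //; exact: ae_boundedN.
- apply: ae_boundedD; last apply: ae_boundedN.
    by do 2 apply: ae_boundedM => //.
  by do 2 apply: ae_boundedM => //.
apply: aeW => x Bx; rewrite /chi' clamp_enorm// -/(@radial_potential R n chi x) -/phi.
have V0 : 0 <= V (r x) by exact: iterate_ge0.
have := tangent_below rF (u0 x Bx) V0.
rewrite !nonneg_extensionE ?u0// => T.
have W : 0 <= lam * weight al (r x) * phi x.
  by rewrite mulr_ge0 ?phi0// mulr_ge0// weight_ge0.
rewrite -subr_ge0 [leRHS](_ : _ = lam * weight al (r x) * phi x *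
  (F (u x) - (F (V (r x)) + nonneg_derivative F (V (r x)) * (u x - V (r x))))).
  by rewrite mulr_ge0// subr_ge0.
by ring.
Qed.

(** Against the weight chi = max(V_k - M, 0), the comparison forces the integral
of chi^2 to be nonpositive. As V_k is largest at the origin, V_k(0) > M would
make chi positive on a whole ball. *)
Lemma iterate_bounded (M : R) : {ae mu, forall x, B x -> u x <= M} ->
  forall k t, iterate n al F lam k t <= M.
Proof.
move=> uM k t; pose V := iterate n al F lam k.
suff V0M : V 0 <= M.
  apply: le_trans V0M; have /andP[c0 c1] := clamp_itv t.
  have -> : iterate n al F lam k t = V (clamp t).
    by rewrite /V; case: (k) => //= m; rewrite (clampE (clamp_itv t)).
  exact: iterate_antitone.
rewrite leNgt; apply/negP => MV.
have cV : continuous V by exact: iterate_continuous.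
pose chi s := Num.max (V s - M) 0.
have cchi : continuous chi.
  move=> s; apply: (@continuous_max _ R (fun s => V s - M) (fun=> 0)).
    by apply: cvgB; [exact: cV|exact: cvg_cst].
  exact: cvg_cst.
have chi0 s : 0 <= chi s by rewrite /chi le_max lexx orbT.
have bchi : ae_bounded (fun x => chi (r x)) by exact: ae_bounded_radial.
have bV : ae_bounded (fun x => V (r x)) by exact: ae_bounded_radial.
have H1 := iterate_comparison k cchi chi0.
have H2 : \int[mu]_(x in B) ((u x - iterate n al F lam k (r x)) * chi (r x)) <=
    \int[mu]_(x in B) (- (chi (r x) * chi (r x))).
  apply: ae_le_Rintegral.
  - by apply: ae_boundedM => //; apply: ae_boundedD => //; exact: ae_boundedN.
  - by apply: ae_boundedN; exact: ae_boundedM.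
  move: uM; apply: filterS => x h Bx; rewrite -mulNr.
  have ux := h Bx; rewrite -/V.
  have [c|c] := leP (V (r x) - M) 0.
    by rewrite /chi max_r// !mulr0.
  by rewrite /chi (max_l (ltW c)); apply: ler_wpM2r; [exact: ltW|lra].
pose c := (V 0 - M) / 2.
have c0 : 0 < c by rewrite /c; lra.
have /cvgrPdist_lt/(_ _ c0)[d /= d0 Hd] := cV 0.
pose A := [set x : 'rV[R]_n.+1 | enorm x < Num.min d 1].
have mA : measurable A := measurable_enorm_lt _.
have AB : A `<=` B by move=> x; rewrite /A /= lt_min => /andP[].
have H3 : c ^+ 2 * fine (mu A) <= \int[mu]_(x in B) (chi (r x) * chi (r x)).
  have iA : mu.-integrable A (EFin \o (fun x => chi (r x) * chi (r x))).
    apply: integrableS AB _ => //.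
    exact/ae_bounded_integrable/ae_boundedM.
  apply: (@le_trans _ _ (\int[mu]_(x in A) (chi (r x) * chi (r x)))).
    rewrite -Rintegral_cst//; apply: le_Rintegral => //.
      apply: (@bounded_integrable _ _ _ mu A mA _ _ `|c ^+ 2|) => //.
        apply: le_lt_trans unit_ball_finite.
        by apply: le_measure; rewrite ?inE.
      exact: aeW.
    move=> x; rewrite /A /= lt_min => /andP[xd x1].
    have Vx : c <= chi (r x).
      rewrite /chi le_max; apply/orP; left.
      have := Hd (r x); rewrite /= sub0r normrN ger0_norm ?enorm_ge0// => /(_ xd).
      by rewrite ltr_norml /c; lra.
    by rewrite expr2 ler_pM// ltW.
  rewrite /Rintegral fine_le//.
  - exact: integrable_fin_num.
  - by apply: integrable_fin_num => //; exact/ae_bounded_integrable/ae_boundedM.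
  apply: ge0_subset_integral => //.
    by have [m _] := ae_boundedM bchi bchi; exact/measurable_EFinP.
  by move=> x _; rewrite lee_fin mulr_ge0.
have pA : 0 < fine (mu A).
  apply: fine_gt0; apply/andP; split.
    by apply: small_ball_pos; rewrite lt_min d0 ltr01.
  apply: le_lt_trans unit_ball_finite.
  by apply: le_measure; rewrite ?inE.
have H4 : \int[mu]_(x in B) (- (chi (r x) * chi (r x))) =
    - \int[mu]_(x in B) (chi (r x) * chi (r x)).
  under eq_Rintegral do rewrite -mulN1r.
  rewrite RintegralZl ?mulN1r//.
  exact/ae_bounded_integrable/ae_boundedM.
have := mulr_gt0 (exprn_gt0 2 c0) pA; rewrite H4 in H2; lra.
Qed.

End one_solution.

Lemma classical_iterates_bounded (lam : R) (u : 'rV[R]_n.+1 -> R) : 0 <= lam ->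
  classical_solution al F lam u ->
  exists M, forall k t, iterate n al F lam k t <= M.
Proof.
move=> l0 su; have [_ /ess_bounded[M _ uM]] := su.
exists M; apply: (iterate_bounded l0 su); move: uM; apply: filterS => x h Bx.
by apply: (le_trans (ler_norm _)); exact: h.
Qed.

End comparison.

(** * Uniform bounds below the extremal parameter *)

Section uniform_bound.
Context {R : realType}.
Variables (n : nat) (al : R) (F : R -> R).
Hypothesis al0 : 0 <= al.
Hypothesis rF : regular_nonlinearity F.
Local Notation sol lam := (radial_solution n al F lam).
Local Notation src lam := (source al F lam (sol lam)).

Section one_parameter.
Variables (lam M : R).
Hypotheses (l0 : 0 < lam) (iM : forall k r, iterate n al F lam k r <= M).

Let l0' : 0 <= lam. Proof. exact: ltW. Qed.
Let csol : continuous (sol lam).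
Proof. exact: (radial_solution_continuous al0 rF l0' iM). Qed.

Lemma src_continuous : continuous (src lam).
Proof. exact: source_continuous. Qed.

Lemma solE (r : R) : 0 <= r <= 1 -> sol lam r = potential n (src lam) (r ^+ 2).
Proof.
by move=> r01; rewrite {1}(radial_solution_fixpoint al0 rF l0' iM) clampE.
Qed.

Lemma sol_ge0 (r : R) : 0 <= sol lam r.
Proof. exact: (radial_solution_ge0 al0 rF l0' iM). Qed.

Lemma src_ge0 (r : R) : 0 <= src lam r.
Proof. exact: source_ge0. Qed.

Lemma sol_antitone (s t : R) : 0 <= s -> s <= t -> t <= 1 -> sol lam t <= sol lam s.
Proof.
move=> s0 st t1; rewrite !solE; [|lra|lra].
apply: potential_antitone => //; first exact: src_continuous.
by move=> x _; exact: src_ge0.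
Qed.

Lemma sol_clamp (r : R) : sol lam r = sol lam (clamp r).
Proof.
rewrite (radial_solution_fixpoint al0 rF l0' iM).
rewrite [RHS](radial_solution_fixpoint al0 rF l0' iM).
by rewrite (clampE (clamp_itv r)).
Qed.

Lemma src_lower (r : R) : 0 < r <= 1 -> forall x, r / 2 <= x <= r ->
  lam * (r / 2) `^ al * F (sol lam r) <= src lam x.
Proof.
move=> /andP[r0 r1] x /andP[rx xr]; rewrite /source -mulrA -[leRHS]mulrA.
apply: ler_wpM2l => //; apply: ler_pM.
- exact: powR_ge0.
- by apply: le_trans (nonlinearity_ge1 rF (sol_ge0 r)).
- rewrite /weight clampE; last by lra.
  by apply: ge0_ler_powR; rewrite ?nnegrE//; lra.
- rewrite -(nonneg_extensionE F (sol_ge0 r)); apply: nonneg_extension_mono => //.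
  by apply: sol_antitone => //; lra.
Qed.

(** The kernel is positive and the solution decreasing, so the solution at r
dominates a multiple of its own source at r. *)
Lemma sol_lower (r : R) : 0 < r <= 1 ->
  lam * (r / 2) `^ al * F (sol lam r) * (r / 2) ^+ n.+1 * (1 - r) <= sol lam r.
Proof.
move=> /[dup] r01 /andP[r0 r1]; rewrite [leRHS]solE; last by lra.
apply: le_trans (flux_le_potential n src_continuous _ r01); last first.
  by move=> x _; exact: src_ge0.
apply: ler_wpM2r; first by lra.
apply: flux_lower => //.
- exact: src_continuous.
- by move=> x _; exact: src_ge0.
- by rewrite !mulr_ge0 ?powR_ge0//; exact: le_trans (nonlinearity_ge1 rF (sol_ge0 r)).
- exact: src_lower.
Qed.

Lemma sol_gt0 (r : R) : 0 < r < 1 -> 0 < sol lam r.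
Proof.
move=> /andP[r0 r1]; apply: lt_le_trans (sol_lower (r := r) _); last by lra.
have F1 := nonlinearity_ge1 rF (sol_ge0 r).
have r2 : 0 < r / 2 by lra.
rewrite mulr_gt0//; last by lra.
rewrite mulr_gt0 ?exprn_gt0// mulr_gt0//; last by lra.
by rewrite mulr_gt0// powR_gt0.
Qed.

Lemma sol_derive (r : R) : 0 < r < 1 ->
  is_derive r 1 (sol lam) (- (r * slope n (src lam) r)).
Proof.
move=> /andP[r0 r1].
apply: near_eq_is_derive (radial_derive n src_continuous (ltW r0)).
near=> x; rewrite solE//; apply/andP; split; apply: ltW.
  by near: x; exact: lt_nbhsr.
by near: x; exact: lt_nbhsl.
Unshelve. all: by end_near. Qed.

Definition linearization (r : R) : R :=
  lam * r `^ al * nonneg_derivative F (sol lam r).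

Lemma src_derive (r : R) : 0 < r < 1 -> is_derive r 1 (src lam)
  (al * src lam r / r - linearization r * (r * slope n (src lam) r)).
Proof.
move=> r01; have /andP[r0 r1] := r01.
have u0 := sol_gt0 r01.
have d1 : is_derive r 1 (fun x => lam * x `^ al) (lam * (al * r `^ al / r)).
  exact: is_deriveZ_fun (is_derive_powR_fun al r0).
have d2 := @is_derive1_comp R F (sol lam) r _ _ (nonneg_derivative_pos rF u0)
  (sol_derive r01).
have d3 := is_deriveM_fun d1 d2.
apply: is_derive_eq (near_eq_is_derive _ d3) _.
  near=> x; rewrite /source /= (nonneg_extensionE F (sol_ge0 x)) /weight clampE//.
  apply/andP; split; apply: ltW.
    by near: x; exact: lt_nbhsr.
  by near: x; exact: lt_nbhsl.
rewrite /linearization /source /= (nonneg_extensionE F (sol_ge0 r)) /weight clampE.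
  by field; rewrite gt_eqF.
by lra.
Unshelve. all: by end_near. Qed.

End one_parameter.

(** The witness w is the difference of the radial solutions for lam' and lam. It
is positive since its source is at least (lam' - lam) |x|^alpha, and it is a
supersolution of the linearized equation by convexity of F. *)
Lemma stable_pair (lam lam' M : R) : 0 < lam -> lam < lam' ->
  (forall k r, iterate n al F lam' k r <= M) ->
  exists w W1 G C, stable_radial_data n al (sol lam)
    (fun r => r * slope n (src lam) r) (src lam) (linearization lam) w W1 G C.
Proof.
move=> l0 ll iM'; have l0' : 0 < lam' by exact: lt_trans ll.
have iM k r : iterate n al F lam k r <= M.
  exact: le_trans (iterate_mono n al0 rF _ _ (ltW l0) (ltW ll)) (iM' _ _).
have c1 := src_continuous l0 iM; have c2 := src_continuous l0' iM'.
pose G r := src lam' r - src lam r.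
have cG : continuous G by move=> r; apply: cvgB; [exact: c2|exact: c1].
have uu r : sol lam r <= sol lam' r.
  exact: (radial_solution_mono al0 rF _ (ltW l0) (ltW ll) iM').
have Gge r : (lam' - lam) * weight al r <= G r.
  rewrite /G /source.
  have F1 := nonneg_extension_ge1 rF (sol lam r).
  have F2 := nonneg_extension_mono rF (uu r).
  have w0 := weight_ge0 al r.
  have h1 : lam' * weight al r * nonneg_extension F (sol lam r) <=
      lam' * weight al r * nonneg_extension F (sol lam' r).
    by apply: ler_wpM2l => //; rewrite mulr_ge0// ltW.
  have h2 : (lam' - lam) * weight al r * 1 <=
      (lam' - lam) * weight al r * nonneg_extension F (sol lam r).
    by apply: ler_wpM2l => //; rewrite mulr_ge0// subr_ge0 ltW.
  lra.
have G0 r : 0 <= G r.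
  by apply: le_trans (Gge r); rewrite mulr_ge0 ?weight_ge0// subr_ge0 ltW.
pose w r := potential n G (r ^+ 2).
have wE r : 0 <= r <= 1 -> w r = sol lam' r - sol lam r.
  move=> r01; rewrite /w (solE l0 iM r01) (solE l0' iM' r01).
  exact: potentialB.
pose C := lam * nonneg_extension F M.
exists w, (fun r => - (r * slope n G r)), G, C; split.
- by move=> r r01; exact: (sol_derive l0 iM r01).
- by move=> r /andP[r0 _]; exact: moment_derive.
- by move=> r r01; exact: (src_derive l0 iM r01).
- by move=> r /andP[r0 _]; apply: radial_derive => //; exact: ltW.
- move=> r /andP[r0 _].
  have := is_deriveZ_fun (-1) (moment_derive n cG r0).
  rewrite (_ : (fun y => -1 * (y * slope n G y)) = (fun y => - (y * slope n G y))).
    by move=> H; apply: is_derive_eq H _; ring.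
  by apply/funext => y; rewrite mulN1r.
move=> r /[dup] r01 /andP[r0 r1].
have s0 : 0 <= slope n G r by apply: slope_ge0 => //; exact: ltW.
have bnd x : 0 <= src lam x <= C.
  rewrite (src_ge0 l0)//= /source /C; apply: ler_pM.
  - by rewrite mulr_ge0// ?weight_ge0// ltW.
  - exact: le_trans (nonneg_extension_ge1 rF _).
  - by rewrite ler_piMr ?weight_le1// ltW.
  - by apply: nonneg_extension_mono => //; exact: (radial_solution_le al0 rF (ltW l0) iM).
have /andP[p0 pC] := slope_bound n c1 (ltW r0) bnd.
split.
- have fl : flux n G r * (1 - r) <= w r.
    by apply: flux_le_potential => //; lra.
  apply: lt_le_trans fl; rewrite mulr_gt0//; last by lra.
  have r2 : 0 < r / 2 by lra.
  apply: (@lt_le_trans _ _ ((lam' - lam) * (r / 2) `^ al * (r / 2) ^+ n.+1)).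
    by rewrite !mulr_gt0 ?exprn_gt0 ?powR_gt0// subr_gt0.
  apply: flux_lower => //.
  + by lra.
  + by rewrite mulr_ge0 ?powR_ge0// subr_ge0 ltW.
  move=> x /andP[rx xr]; apply: le_trans (Gge x).
  apply: ler_wpM2l; first by rewrite subr_ge0 ltW.
  rewrite /weight clampE; last by lra.
  by apply: ge0_ler_powR; rewrite ?nnegrE//; lra.
- by rewrite oppr_le0 mulr_ge0// ltW.
- rewrite wE; last by lra.
  have T := tangent_below rF (sol_ge0 l0' iM' r) (sol_ge0 l0 iM r).
  rewrite /linearization /G /source /weight clampE; last by lra.
  rewrite (nonneg_extensionE F (sol_ge0 l0 iM r)) (nonneg_extensionE F (sol_ge0 l0' iM' r)).
  have q0 : 0 <= r `^ al by exact: powR_ge0.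
  have h1 : lam * r `^ al * F (sol lam' r) <= lam' * r `^ al * F (sol lam' r).
    apply: ler_wpM2r; first exact: le_trans (nonlinearity_ge1 rF (sol_ge0 l0' iM' r)).
    by apply: ler_wpM2r => //; exact: ltW.
  have h2 := ler_wpM2l (mulr_ge0 (ltW l0) q0) T.
  rewrite mulrDr mulrA in h2; lra.
- exact: src_ge0.
- rewrite mulr_ge0//=; last exact: ltW.
  by rewrite mulrC ler_wpM2r// ltW.
Qed.

(** By [sol_lower] at r = 1/2, the value t there satisfies F(t) <= K t with K independent
of lam, hence is bounded; this bounds the flux on [0, 1/2], and
[stable_radial_bound] does the rest. *)
Lemma uniform_bound (lam0 : R) : 0 < lam0 -> n.+1%:R < 10 + 4 * al ->
  exists K, forall lam lam' M, lam0 <= lam -> lam < lam' ->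
    (forall k r, iterate n al F lam' k r <= M) ->
    forall r, sol lam r <= K.
Proof.
move=> l00 nal.
pose c1 := lam0 * (1 / 2 / 2) `^ al * (1 / 2 / 2) ^+ n.+1 * (1 - 1 / 2).
have c10 : 0 < c1.
  rewrite /c1 mulr_gt0//; last by lra.
  by rewrite mulr_gt0// ?exprn_gt0 ?mulr_gt0// ?powR_gt0//; lra.
have [M0 M00 HM0] := superlinear rF c1^-1.
have M20 : 0 <= 2 * M0 by rewrite mulr_ge0.
have [C' HC'] := stable_radial_bound al0 nal M20.
exists (M0 + `|C'|) => lam lam' M ll0 ll iM'.
have l0 : 0 < lam by exact: lt_le_trans ll0.
have iM k r : iterate n al F lam k r <= M.
  exact: le_trans (iterate_mono n al0 rF _ _ (ltW l0) (ltW ll)) (iM' _ _).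
have h01 : 0 < (1 / 2 : R) <= 1 by lra.
have half : sol lam (1 / 2) <= M0.
  apply: HM0; first by apply: (sol_gt0 l0 iM); lra.
  rewrite [leRHS]mulrC ler_pdivlMr//; apply: le_trans (sol_lower l0 iM h01).
  have F0 : 0 <= F (sol lam (1 / 2)).
    exact: le_trans (nonlinearity_ge1 rF (sol_ge0 l0 iM _)).
  have -> : F (sol lam (1 / 2)) * c1 = lam0 * ((1 / 2 / 2) `^ al *
    F (sol lam (1 / 2)) * (1 / 2 / 2) ^+ n.+1 * (1 - 1 / 2)).
    by rewrite /c1; ring.
  rewrite -!mulrA; apply: ler_wpM2r => //.
  by rewrite !mulr_ge0 ?powR_ge0 ?exprn_ge0//; lra.
have [w [W1 [G [C data]]]] := stable_pair l0 ll iM'.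
have zA r : 0 < r <= 1 / 2 -> r * slope n (src lam) r * r ^+ n <= 2 * M0.
  move=> /andP[r0 r1]; have r0' : r != 0 by rewrite gt_eqF.
  have -> : r * slope n (src lam) r * r ^+ n = flux n (src lam) r.
    by rewrite /slope r0 exprS; field; rewrite r0' expf_neq0.
  have cs := src_continuous l0 iM.
  have s0 x : 0 <= x <= 1 -> 0 <= src lam x by move=> _; exact: (src_ge0 l0).
  have f1 : flux n (src lam) r <= flux n (src lam) (1 / 2).
    by apply: flux_nondecreasing => //; lra.
  have f2 := flux_le_potential n cs s0 h01.
  have f3 := solE l0 iM (r := 1 / 2); rewrite -f3 in f2; last by lra.
  lra.
have key r : 0 < r <= 1 -> sol lam r <= M0 + `|C'|.
  move=> /andP[r0 r1]; have [rh|rh] := leP r (1 / 2).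
    have := HC' _ _ _ _ _ _ _ _ data zA r; rewrite r0 rh => /(_ isT).
    by have := ler_norm C'; lra.
  have : sol lam r <= sol lam (1 / 2) by apply: (sol_antitone l0 iM); lra.
  by have := normr_ge0 C'; lra.
move=> r; rewrite (sol_clamp l0 iM); have /andP[] := clamp_itv r.
move: (clamp r) => {}r; rewrite le_eqVlt => /predU1P[<- _|r0 r1]; last first.
  by apply: key; rewrite r0.
have cv : sol lam x @[x --> 0^'+] --> sol lam 0.
  apply: cvg_at_right_filter.
  exact: (radial_solution_continuous al0 rF (ltW l0) iM).
apply: (cvgr_to_le cv); near=> x; apply: key; apply/andP; split.
  by near: x; exact: nbhs_right_gt.
by near: x; exact: nbhs_right_le.
Unshelve. all: by end_near. Qed.

End uniform_bound.

(** * The extremal solution *)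

Section minimal_solutions.
Context {R : realType} {n : nat}.
Variables (al : R) (F : R -> R).
Hypothesis al0 : 0 <= al.
Hypothesis rF : regular_nonlinearity F.
Local Notation B := (unit_ball R n.+1).
Local Notation mu := (lebesgue_rV R n.+1).
Local Notation Fp := (nonneg_extension F).

Let mB : measurable B. Proof. exact: measurable_unit_ball. Qed.

Lemma ae_bounded_growth (u : 'rV[R]_n.+1 -> R) : ae_bounded u ->
  (forall x, B x -> 0 <= u x) ->
  mu.-integrable B (fun x => (enorm x `^ al * F (u x) * (1 - enorm x))%:E).
Proof.
move=> bu u0.
have H : mu.-integrable B (EFin \o (fun x => weight al (enorm x) * Fp (u x) *
    (1 - enorm x))).
  apply: ae_bounded_integrable; apply: ae_boundedM.
    apply: ae_boundedM; last exact: ae_bounded_nonlinearity.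
    by apply: ae_bounded_radial; exact: weight_continuous.
  apply: (ae_bounded_radial (h := fun t => 1 - t)) => t.
  by apply: cvgB; [exact: cvg_cst|exact: cvg_id].
apply: eq_integrable H => // x; rewrite inE => Bx.
by rewrite /= weight_enorm// nonneg_extensionE// u0.
Qed.

Lemma radial_solution_classical (lam M : R) : 0 <= lam ->
  (forall k r, iterate n al F lam k r <= M) ->
  classical_solution al F lam
    (fun x : 'rV[R]_n.+1 => radial_solution n al F lam (enorm x)).
Proof.
move=> l0 iM; set V := radial_solution n al F lam.
have cV : continuous V := radial_solution_continuous al0 rF l0 iM.
have bV : ae_bounded (fun x : 'rV[R]_n.+1 => V (enorm x)).
  exact: ae_bounded_radial.
have V0 r : 0 <= V r by exact: (radial_solution_ge0 al0 rF l0 iM).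
split; last first.
  apply: (@bounded_ess _ _ _ M); apply: aeW => x _.
  by rewrite ger0_norm// (radial_solution_le al0 rF l0 iM).
split=> [x _//| | |phi tphi].
- exact: ae_bounded_integrable.
- by apply: ae_bounded_growth => // x _.
pose S := source al F lam V.
have cS : continuous S by exact: source_continuous.
have tS : test_function (@radial_potential R n S) by exact: radial_potential_test.
transitivity (\int[mu]_(x in B) (@radial_potential R n S x * - laplacian phi x)).
  apply: eq_Rintegral => x; rewrite inE => Bx.
  by rewrite /V (radial_solution_fixpoint al0 rF l0 iM) clamp_enorm.
rewrite green_identity//; apply: eq_Rintegral => x; rewrite inE => Bx.
rewrite laplacian_radial_potential// opprK mulrC; congr (_ * _).
by rewrite /S /source weight_enorm// nonneg_extensionE.
Qed.

(** A bounded solution for the larger parameter lam' bounds the radial iterates for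
lam', hence for lam; the radial solution for lam is then a competitor in the
minimality of u. *)
Lemma minimal_solution_le (lam lam' K : R) (u v : 'rV[R]_n.+1 -> R) :
  0 < lam -> lam < lam' ->
  minimal_classical_solution al F lam u -> classical_solution al F lam' v ->
  (forall M, (forall k r, iterate n al F lam' k r <= M) ->
    forall r, radial_solution n al F lam r <= K) ->
  {ae mu, forall x, B x -> `|u x| <= K}.
Proof.
move=> l0 ll [cu umin] cv HK.
have l0' : 0 <= lam' by exact/ltW/(lt_trans l0).
have [M iM'] := classical_iterates_bounded al0 rF l0' cv.
have iM k r : iterate n al F lam k r <= M.
  exact: le_trans (iterate_mono n al0 rF _ _ (ltW l0) (ltW ll)) (iM' _ _).
have [wV _] := radial_solution_classical (ltW l0) iM.
have [[u0 _ _ _] _] := cu.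
move: (umin _ wV); apply: filterS => x h Bx.
by rewrite ger0_norm ?u0//; apply: (le_trans (h Bx)); exact: (HK _ iM').
Qed.

(** Both sides of the weak equation converge by bounded convergence, the test
function being bounded with its Laplacian. *)
Lemma weak_solution_limit (lam_ : nat -> R) (lam K : R)
    (u_ : nat -> 'rV[R]_n.+1 -> R) (u : 'rV[R]_n.+1 -> R) :
  lam_ @ \oo --> lam ->
  (forall k, weak_solution al F (lam_ k) (u_ k)) ->
  (forall k, {ae mu, forall x, B x -> `|u_ k x| <= K}) ->
  measurable_fun B u -> (forall x, B x -> 0 <= u x) ->
  {ae mu, forall x, B x -> u_ ^~ x @ \oo --> u x} ->
  classical_solution al F lam u.
Proof.
move=> laml w_ uK mu' u0 uu.
have bu : {ae mu, forall x, B x -> `|u x| <= K}.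
  have /ae_foralln := uK => uK'.
  move: uK' uu; apply: filterS2 => x h1 h2 Bx.
  apply: (cvgr_to_le (cvg_norm (h2 Bx))); apply: nearW => k.
  exact: h1.
have bu' : ae_bounded u by split; last by exists K.
have bu_ k : ae_bounded (u_ k).
  split; last by exists K; exact: uK.
  by have [_ /integrableP[/measurable_EFinP]] := w_ k.
split; last exact: bounded_ess bu.
split=> // [| |phi tphi].
- exact: ae_bounded_integrable.
- exact: ae_bounded_growth.
have EL : extends_to_closed_ball (fun x => - laplacian phi x).
  by apply: extensionN; exact: extension_laplacian.
have [L L0 HL] := extension_bounded EL.
have [P P0 HP] := extension_bounded (test_extension tphi).
have bL := ae_bounded_extension EL.
have bP := ae_bounded_extension (test_extension tphi).
have c1 : (\int[mu]_(x in B) (u_ k x * - laplacian phi x)) @[k --> \oo] -->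
    \int[mu]_(x in B) (u x * - laplacian phi x).
  apply: (@bounded_cvg_Rintegral _ _ _ mu B mB unit_ball_finite _ _ (K * L)).
  - by move=> k; case: (ae_boundedM (bu_ k) bL).
  - by case: (ae_boundedM bu' bL).
  - move=> k; move: (uK k); apply: filterS => x h Bx.
    by rewrite normrM ler_pM// ?h// HL.
  - move: uu; apply: filterS => x h Bx.
    by apply: cvgM; [exact: h|exact: cvg_cst].
have bw : ae_bounded (fun x : 'rV[R]_n.+1 => weight al (enorm x)).
  by apply: ae_bounded_radial; exact: weight_continuous.
have bG v : ae_bounded v ->
    ae_bounded (fun x => weight al (enorm x) * Fp (v x) * phi x).
  move=> bv; apply: ae_boundedM => //; apply: ae_boundedM => //.
  exact: ae_bounded_nonlinearity.
have c2 : (\int[mu]_(x in B) (weight al (enorm x) * Fp (u_ k x) * phi x))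
    @[k --> \oo] -->
    \int[mu]_(x in B) (weight al (enorm x) * Fp (u x) * phi x).
  apply: (@bounded_cvg_Rintegral _ _ _ mu B mB unit_ball_finite _ _ (Fp K * P)).
  - by move=> k; case: (bG _ (bu_ k)).
  - by case: (bG _ bu').
  - move=> k; move: (uK k); apply: filterS => x h Bx.
    have F1 (t : R) : 0 <= Fp t by exact: le_trans (nonneg_extension_ge1 rF _).
    rewrite normrM ler_pM// ?HP// normrM ger0_norm ?weight_ge0// ger0_norm//.
    rewrite -[leRHS]mul1r ler_pM ?weight_ge0 ?weight_le1//.
    by apply: nonneg_extension_mono => //; apply: (le_trans (ler_norm _)); exact: h.
  - move: uu; apply: filterS => x h Bx.
    apply: cvgM; last exact: cvg_cst.
    apply: cvgM; first exact: cvg_cst.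
    apply: (@cvg_comp _ _ _ (fun k => u_ k x) Fp); first exact: h.
    exact: nonneg_extension_continuous.
have E (t : R) v : (forall x, B x -> 0 <= v x) -> ae_bounded v ->
    \int[mu]_(x in B) (t * enorm x `^ al * F (v x) * phi x) =
    t * \int[mu]_(x in B) (weight al (enorm x) * Fp (v x) * phi x).
  move=> v0 bv; rewrite -RintegralZl//; last exact/ae_bounded_integrable/bG.
  apply: eq_Rintegral => x; rewrite inE => Bx.
  by rewrite weight_enorm// nonneg_extensionE ?v0// !mulrA.
rewrite E//.
have c3 := cvgM laml c2.
suff c4 : (\int[mu]_(x in B) (u_ k x * - laplacian phi x)) @[k --> \oo] -->
    lam * \int[mu]_(x in B) (weight al (enorm x) * Fp (u x) * phi x).
  exact: cvg_unique c1 c4.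
rewrite [X in X @ _ --> _](_ : _ = (fun k => lam_ k *
    \int[mu]_(x in B) (weight al (enorm x) * Fp (u_ k x) * phi x))).
  exact: c3.
by apply/funext => k; have [v0 _ _ h] := w_ k; rewrite h// E.
Qed.

End minimal_solutions.

Lemma extremal_parameter_gt0 (R : realType) (N : nat) (alpha : R) (F : R -> R)
  (lambdastar : R) : is_extremal_parameter N alpha F lambdastar -> 0 < lambdastar.
Proof.
rewrite /is_extremal_parameter; set A := [set _ | _ in _] => supA.
have [A0|/set0P[_ [lam [l0 sl] _]]] := eqVneq A set0.
  by move: supA; rewrite A0 ereal_sup0.
apply: (lt_le_trans l0); rewrite -lee_fin -supA; apply: ereal_sup_ubound.
by exists lam.
Qed.

Theorem corollary4p3 (R : realType) (N : nat) (alpha : R) (F : R -> R)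
    (lambdastar : R) (ustar : 'rV[R]_N -> R) :
  (0 < N)%N ->
  regular_nonlinearity F ->
  0 <= alpha ->
  is_extremal_parameter N alpha F lambdastar ->
  extremal_solution alpha F lambdastar ustar ->
  N%:R < 10 + 4 * alpha ->
  classical_solution alpha F lambdastar ustar.
Proof.
case: N ustar => [//|n] ustar _ rF al0 /extremal_parameter_gt0 ls0.
move=> [mustar ustar0 [u [umin ulim]]] nal.
have lh0 : 0 < lambdastar / 2 by lra.
have [K HK] := uniform_bound al0 rF lh0 nal.
have ubound lam : lambdastar / 2 <= lam -> lam < lambdastar ->
    {ae lebesgue_rV R n.+1, forall x, unit_ball R n.+1 x -> `|u lam x| <= K}.
  (* stability at lam needs a solution for a larger parameter *)
  move=> lh ls; pose lam' := (lam + lambdastar) / 2.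
  have ll : lam < lam' by rewrite /lam'; lra.
  have ml : minimal_classical_solution alpha F lam (u lam).
    by apply: umin; lra.
  have [cl' _] : minimal_classical_solution alpha F lam' (u lam').
    by apply: umin; rewrite /lam'; lra.
  apply: (minimal_solution_le al0 rF _ ll ml cl'); first by lra.
  by move=> M; exact: HK.
pose lam_ (k : nat) : R := lambdastar - lambdastar / 2 * k.+1%:R^-1.
have lamh k : lambdastar / 2 <= lam_ k < lambdastar.
  have k0 : (0 : R) < k.+1%:R^-1 by rewrite invr_gt0.
  have k1 : k.+1%:R^-1 <= (1 : R) by rewrite invf_le1// ler1n.
  have h1 := mulr_gt0 lh0 k0.
  have h2 := ler_wpM2l (ltW lh0) k1.
  rewrite /lam_; move: (k.+1%:R^-1) h1 h2 {k0 k1} => t h1 h2; lra.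
have laml : lam_ @ \oo --> lambdastar.
  rewrite -[X in _ --> X]subr0 -[X in _ - X](mulr0 (lambdastar / 2)).
  apply: cvgB; first exact: cvg_cst.
  apply: cvgM; first exact: cvg_cst.
  exact: cvg_harmonic.
apply: (weak_solution_limit al0 rF (u_ := fun k => u (lam_ k)) laml (K := K)) => //.
- move=> k; have /andP[h1 h2] := lamh k.
  by have [[]] : minimal_classical_solution alpha F (lam_ k) (u (lam_ k))
    by apply: umin; lra.
- by move=> k; have /andP[h1 h2] := lamh k; exact: ubound.
- move: ulim; apply: filterS => x h Bx.
  have /cvg_at_leftP := h Bx; apply; split=> // k.
  by have /andP[] := lamh k.
Qed.
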